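(* For every graph $F$, there exists an integer $\alpha\ge 1$ such that for every graph $G$: if $G$ does not contain $F$ as a strong immersion, then every $\alpha$-edge-connected subset of $V(G)$ is $\alpha$-linear in $G$.
   Context: Graphs are finite and may have parallel edges and loops (each loop contributes $2$ to the degree of its vertex). Strong immersion. An immersion of $H$ in $G$ is a function $\theta$ on the vertices and edges of $H$ such that: (i) $\theta(v)\in V(G)$ for each $v\in V(H)$, and $\theta$ restricted to $V(H)$ is injective; (ii) $\theta(e)$ is a connected subgraph of $G$ for each $e\in E(H)$, and $\theta(e),\theta(f)$ are edge-disjoint for distinct $e,f\in E(H)$; (iii) if $e\in E(H)$ is incident with $v\in V(H)$, then $\theta(v)$ is a vertex of $\theta(e)$, and if $e$ is a loop, then $\theta(e)$ contains a cycle passing through $\theta(v)$ (a loop or a pair of parallel edges counts as a cycle). The immersion is strong if moreover, whenever $e\in E(H)$ is not incident with $v\in V(H)$, $\theta(e)$ does not contain $\theta(v)$. ''$G$ contains $H$ as a strong immersion'' means such a strong $\theta$ exists. Edge-connected sets. For an integer $k\ge 1$, a set $W\subseteq V(G)$ is $k$-edge-connected if no two vertices of $W$ are separated by an edge-cut of size less than $k$ in $G$. Path-like decompositions. A near-partition of a set $Z$ is a family of pairwise disjoint, possibly empty, subsets of $Z$ with union $Z$. For $X\subseteq V(G)$, a path-like decomposition $\mathcal{P}$ of $G$ with respect to $X$ is an ordering $x_1,\dots,x_t$ of the vertices of $X$ together with a near-partition $B_0,\dots,B_t$ of $V(G)\setminus X$; the sets $B_i$ are its bags. The $x_i$-cut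 is the set of edges of $G$ with one endpoint in $\{x_1,\dots,x_{i-1}\}\cup B_0\cup\dots\cup B_{i-1}$ and the other endpoint in $\{x_{i+1},\dots,x_t\}\cup B_i\cup\dots\cup B_t$. The width of $\mathcal{P}$ is the maximum size of an $x$-cut over $x\in X$ (it is $0$ if $X=\emptyset$). For a set $Z$ of vertices, $b_{\mathcal{P}}(Z)$ is the number of bags of $\mathcal{P}$ that intersect $Z$; for an integer $p\ge 0$, $Z$ is $p$-bounded in $\mathcal{P}$ if $|X\cap Z|+b_{\mathcal{P}}(Z)\le p$. Linear sets. A set $W\subseteq V(G)$ is $\alpha$-linear if there exists $A\subseteq W$ with $|A|\le\alpha$ such that $G-A$ has a path-like decomposition $\mathcal{P}$ with respect to $W\setminus A$ of width less than $\alpha$ and the neighborhood (in $G$) of every vertex of $A$ is $\alpha$-bounded in $\mathcal{P}$. *)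

(* Defs.v *)
From mathcomp Require Import all_boot.

Set Implicit Arguments.
Unset Strict Implicit.
Unset Printing Implicit Defensive.

(** * Multigraphs

    Plain Mathematical Components.  A finite graph with loops and parallel edges
    is given by the two ends of each edge; the order of the ends is an artefact
    of the encoding, and every notion below is symmetric in [src] and [tgt]. *)

Record mgraph := MGraph {
  vert : finType;
  edge : finType;
  src : edge -> vert;
  tgt : edge -> vert
}.

Definition joins (G : mgraph) (e : edge G) (u v : vert G) : bool :=
  ((src e == u) && (tgt e == v)) || ((src e == v) && (tgt e == u)).

Definition incident (G : mgraph) (e : edge G) (v : vert G) : bool :=
  (src e == v) || (tgt e == v).

Definition is_loop (G : mgraph) (e : edge G) : bool := src e == tgt e.

Definition neighborhood (G : mgraph) (v : vert G) : {set vert G} :=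
  [set u | [exists e : edge G, joins e v u]].

Definition edges_between (G : mgraph) (L R : {set vert G}) : {set edge G} :=
  [set e | ((src e \in L) && (tgt e \in R)) || ((src e \in R) && (tgt e \in L))].

Definition del_verts (G : mgraph) (A : {set vert G}) : mgraph :=
  @MGraph {v : vert G | v \notin A}
          {e : edge G | (src e \notin A) && (tgt e \notin A)}
          (fun e => exist _ (src (val e)) (proj1 (andP (valP e))))
          (fun e => exist _ (tgt (val e)) (proj2 (andP (valP e)))).

(** * Subgraphs *)

Record subgraph (G : mgraph) := Subgraph {
  sverts : {set vert G};
  sedges : {set edge G};
  sedgesP : [forall e in sedges, (src e \in sverts) && (tgt e \in sverts)]
}.

Definition sub_adj (G : mgraph) (S : subgraph G) : rel (vert G) :=
  fun u v => [exists e in sedges S, joins e u v].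

Definition connected (G : mgraph) (S : subgraph G) : Prop :=
  sverts S != set0 /\ {in sverts S &, forall u v, connect (sub_adj S) u v}.

(** [ordS i] is the successor of [i] modulo [k]: a loop is a cycle ([k = 1])
    and so is a pair of parallel edges ([k = 2]). *)
Definition is_cycle (G : mgraph) (C : subgraph G) : Prop :=
  exists (k : nat) (x : 'I_k -> vert G) (y : 'I_k -> edge G),
    [/\ 0 < k, injective x, injective y,
        (forall i, joins (y i) (x i) (x (ordS i)))
      & sverts C = [set x i | i : 'I_k] /\ sedges C = [set y i | i : 'I_k]].

Definition contains_cycle_through (G : mgraph) (S : subgraph G) (v : vert G) :
    Prop :=
  exists C : subgraph G,
    [/\ is_cycle C, sverts C \subset sverts S, sedges C \subset sedges S
      & v \in sverts C].

(** * Strong immersions *)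

Definition is_immersion (H G : mgraph)
    (thv : vert H -> vert G) (the : edge H -> subgraph G) : Prop :=
  [/\ injective thv,
      (forall e, connected (the e)),
      (forall e f, e != f -> [disjoint sedges (the e) & sedges (the f)]),
      (forall e v, incident e v -> thv v \in sverts (the e))
    & (forall e v, incident e v -> is_loop e ->
         contains_cycle_through (the e) (thv v))].

Definition is_strong_immersion (H G : mgraph)
    (thv : vert H -> vert G) (the : edge H -> subgraph G) : Prop :=
  is_immersion thv the /\
  (forall e v, ~~ incident e v -> thv v \notin sverts (the e)).

Definition contains_strong_immersion (G H : mgraph) : Prop :=
  exists (thv : vert H -> vert G) (the : edge H -> subgraph G),
    is_strong_immersion thv the.

(** * Edge-connected sets *)

(** The edge-cut defined by [U] consists of the edges between [U] and its
    complement; it separates [u] and [v] if [u] is in [U] and [v] is not. *)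
Definition edge_connected (G : mgraph) (k : nat) (W : {set vert G}) : Prop :=
  forall u v, u \in W -> v \in W ->
    ~ exists U : {set vert G},
        [/\ u \in U, v \notin U & #|edges_between U (~: U)| < k].

(** * Path-like decompositions *)

(** The ordering is 0-based while the bags are numbered from 0 to t, so the
    order is [bag 0], [pvert 0], [bag 1], [pvert 1], ..., [bag t]: [bag j] lies
    before [pvert i] iff [j <= i]. *)
Record path_like (G : mgraph) (X : {set vert G}) := PathLike {
  plen : nat;
  pvert : 'I_plen -> vert G;
  bag : 'I_plen.+1 -> {set vert G};
  pvert_inj : injective pvert;
  pvert_im : [set pvert i | i : 'I_plen] = X;
  bag_disj : forall i j, i != j -> [disjoint bag i & bag j];
  bag_cover : \bigcup_(j < plen.+1) bag j = ~: X
}.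

Arguments pvert {G X} _ _.
Arguments bag {G X} _ _.

Definition before (G : mgraph) (X : {set vert G}) (P : path_like X)
    (i : 'I_(plen P)) : {set vert G} :=
  [set pvert P j | j : 'I_(plen P) & j < i] :|:
  \bigcup_(j < (plen P).+1 | j <= i) bag P j.

Definition after (G : mgraph) (X : {set vert G}) (P : path_like X)
    (i : 'I_(plen P)) : {set vert G} :=
  [set pvert P j | j : 'I_(plen P) & i < j] :|:
  \bigcup_(j < (plen P).+1 | i < j) bag P j.

Definition vertex_cut (G : mgraph) (X : {set vert G}) (P : path_like X)
    (i : 'I_(plen P)) : {set edge G} :=
  edges_between (before i) (after i).

Definition width (G : mgraph) (X : {set vert G}) (P : path_like X) : nat :=
  \max_(i < plen P) #|vertex_cut i|.

Definition num_bags (G : mgraph) (X : {set vert G}) (P : path_like X)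
    (Z : {set vert G}) : nat :=
  #|[set j : 'I_(plen P).+1 | bag P j :&: Z != set0]|.

Definition bounded (G : mgraph) (X : {set vert G}) (P : path_like X) (p : nat)
    (Z : {set vert G}) : Prop :=
  #|X :&: Z| + num_bags P Z <= p.

(** * Linear sets *)

(** [val] embeds the vertices of [G - A] into those of [G], so [restr A Z] is
    the set [Z :\: A] seen in [G - A].  Neither the bags nor [W :\: A] meet [A],
    so [restr] preserves the two quantities counted by [bounded]. *)
Definition restr (G : mgraph) (A Z : {set vert G}) : {set vert (del_verts A)} :=
  [set v : vert (del_verts A) | val v \in Z].

Definition linear (G : mgraph) (alpha : nat) (W : {set vert G}) : Prop :=
  exists A : {set vert G},
    [/\ A \subset W, #|A| <= alpha
      & exists P : path_like (restr A (W :\: A)),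
          width P < alpha /\
          forall a, a \in A -> bounded P alpha (restr A (neighborhood a))].

(* Main.v *)
Require Import Defs.
From mathcomp Require Import all_boot.
From mathcomp Require Import zify.

Set Implicit Arguments.
Unset Strict Implicit.
Unset Printing Implicit Defensive.

(** Write [n] for the number of vertices of [F].  It suffices to find [n]
    vertices and a hub such that each of them is joined to the hub by many
    edge-disjoint paths avoiding the others: an edge of [F] is then routed through
    the hub.  Take a "free" set [Z] in [W], with hub [h] in [W], of maximum size,
    the connectivity demanded decreasing with the size.  If [Z] has fewer than [n]
    vertices, then adding a vertex [w] near [h] in [G - Z] spoils it, so [w]
    separates some [z] in [Z] from [h] up to a small cut.  A vertex far from [h] is
    well linked to some [z]; replacing [z] by two such vertices spoils the set too,
    so one of them separates the other from [z].  Hence [W - Z] is covered by few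
    chains of small cuts.  In each class of vertices well linked in [G - Z], these
    cuts, directed away from a root, form a forest with few leaves; deleting the
    root and the top of each chain of the forest leaves chains that can be put one
    after the other.  Minimum cuts of minimum size are nested and leave no part of
    a gap detached from the chain; so a vertex of [Z] with neighbours in many gaps
    of a chain would be a hub for [n] vertices of that chain. *)

(** * Routing tokens along arcs *)

(** An edge of [F] becomes two walks, one from each end to the hub. All images share the hub, which
    an immersion allows since only edges must be disjoint. A small cut always lives in the graph
    without [Z] and one further vertex [w]: edges at [w] are free, as in the definition of an
    [x]-cut. Two such cuts have different free vertices, so uncrossing them must never leave an
    uncharged edge at either one; this decides when intersection, union or difference may be used.
    Each uncrossing costs connectivity, hence the scale [b], [g], [beta]: failure of freeness at
    size [#|Z| + 1] yields cuts below [b], linkage classes are taken at [g], and [Z] itself is free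
    at [beta]. Neighbourhoods of all deleted vertices have to be controlled. Roots and tops lie
    outside [Z], so their edges are counted by the cuts of the chains, and this alone bounds the
    gaps they see. Edges at [Z] are invisible to these cuts, and only there is the hub argument
    needed. *)

Section Routing.
Variables (V A J : finType) (tl hd : A -> V) (h : V).
Implicit Types (F : {set A}) (U T : {set V}) (pos : J -> V) (p : seq A).

Definition out F U := #|[set a in F | (tl a \in U) && (hd a \notin U)]|.
Definition load pos U := #|[set j | pos j \in U]|.
Definition routable F pos : bool :=
  [forall U : {set V}, (h \notin U) ==> (load pos U <= out F U)].
Definition critical F pos :=
  routable F pos /\ forall a, a \in F -> ~~ routable (F :\ a) pos.

Fixpoint walk v p : Prop :=
  if p is a :: q then tl a = v /\ walk (hd a) q else v = h.

Lemma out_sum F U : out F U = \sum_(a in F) ((tl a \in U) && (hd a \notin U)).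
Proof.
rewrite /out -sum1_card big_mkcond [RHS]big_mkcond /=.
by apply: eq_bigr => a _; rewrite inE; case: (a \in F) => //; case: (_ && _).
Qed.

Lemma load_sum pos U : load pos U = \sum_(j : J) (pos j \in U).
Proof.
rewrite /load -sum1_card big_mkcond /=.
by apply: eq_bigr => j _; rewrite inE; case: (_ \in _).
Qed.

Lemma load_modular pos U T :
  load pos (U :&: T) + load pos (U :|: T) = load pos U + load pos T.
Proof.
rewrite !load_sum -!big_split /=; apply: eq_bigr => j _; rewrite !inE.
by case: (_ \in U); case: (_ \in T).
Qed.

Lemma out_submodular F U T a : a \in F ->
    tl a \in T -> hd a \notin T -> tl a \notin U -> hd a \in U ->
  out F (U :&: T) + out F (U :|: T) < out F U + out F T.
Proof.
move=> aF tT hT tU hU; rewrite !out_sum -!big_split /= !(bigD1 a aF) /= !inE.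
rewrite tT (negPf hT) (negPf tU) hU /=.
set s1 := (X in X < _); set s2 := (X in _ < X); suff : s1.+1 <= s2 by [].
rewrite /s1 /s2 !add0n add1n ltnS; apply: leq_sum => c _; rewrite !inE.
by case: (tl c \in U); case: (tl c \in T); case: (hd c \in U); case: (hd c \in T).
Qed.

Lemma outD1 F U a : a \in F ->
  out F U = out (F :\ a) U + ((tl a \in U) && (hd a \notin U)).
Proof.
move=> aF; rewrite !out_sum (bigD1 a aF) /= addnC; congr (_ + _).
by apply: eq_bigl => c; rewrite !inE andbC.
Qed.

Lemma routableP F pos :
  reflect (forall U, h \notin U -> load pos U <= out F U) (routable F pos).
Proof.
by apply: (iffP forallP) => H U; [move/implyP: (H U) | apply/implyP/H].
Qed.

(* The arc lies in a tight set [T]; uncrossing [T] with a tight set [U] that the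
   arc enters would violate routability, since the arc joins [T :\: U] to
   [U :\: T] and so is lost in both uncrossed sets. *)
Lemma critical_enter F pos a U : critical F pos -> a \in F ->
    h \notin U -> tl a \notin U -> hd a \in U ->
  load pos U < out F U.
Proof.
move=> [/routableP Fr Fc] aF hU tU hdU; rewrite ltnNge; apply/negP => tight.
have /routableP := Fc a aF; apply=> T hT; rewrite leqNgt; apply/negP => lt.
have := Fr T hT; rewrite (outD1 T aF); case tT: (tl a \in T); last by clear -lt; lia.
case hdT: (hd a \in T); first by move=> /=; clear -lt; lia.
move=> /= le1.
have hUT : h \notin U :|: T by rewrite inE negb_or hU.
have hIT : h \notin U :&: T by rewrite inE negb_and hU.
have := out_submodular aF tT (negbT hdT) tU hdU.
have := Fr _ hUT; have := Fr _ hIT; have := load_modular pos U T.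
by rewrite (outD1 T aF) tT hdT /=; clear -lt le1 tight; lia.
Qed.

Lemma critical_tight F pos a : critical F pos -> a \in F ->
  exists T, [/\ h \notin T, tl a \in T, hd a \notin T & out F T <= load pos T].
Proof.
move=> [/routableP Fr Fc] aF; have /forallPn[T] := Fc a aF.
rewrite negb_imply -ltnNge => /andP[hT lt]; exists T.
have := Fr T hT; move: lt; rewrite (outD1 T aF).
by case: (tl a \in T); case: (hd a \in T) => /= lt1 lt2; split=> //; lia.
Qed.

Lemma critical_exists F pos : routable F pos ->
  exists2 F' : {set A}, F' \subset F & critical F' pos.
Proof.
move=> Fr; have [n] := ubnP #|F|; elim: n F Fr => // n IH F Fr ltn.
have [/exists_inP[a aF ra]|/exists_inPn no] :=
  boolP [exists a in F, routable (F :\ a) pos]; last by exists F.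
have [|F' sF' cF'] := IH _ ra; first by rewrite (cardsD1 a) aF in ltn.
by exists F' => //; apply: subset_trans sF' (subsetDl _ _).
Qed.

(** Menger's theorem, one arc at a time. Over a critical arc set, a token not yet at [h] moves along
    any arc leaving its place, and the arc is discarded. A set that the arc leaves loses one token
    and one arc; a set that it enters gains a token, for which [critical_enter] provides room. *)
Lemma routing F pos : routable F pos ->
  exists p : J -> seq A,
    [/\ forall j, walk (pos j) (p j), forall j a, a \in p j -> a \in F,
        forall j, uniq (p j)
      & forall i j a, a \in p i -> a \in p j -> i = j].
Proof.
have [n] := ubnP #|F|; elim: n F pos => // n IH F pos ltn Fr.
have [F' sF' [Fr' Fc']] := critical_exists Fr.
have [/forallP allh|/forallPn[j jh]] := boolP [forall j, pos j == h].
  by exists (fun _ => [::]); split=> //= j; apply/eqP.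
have : 0 < out F' [set pos j].
  have /routableP := Fr' => /(_ [set pos j]); rewrite inE eq_sym => /(_ jh).
  apply: leq_trans; apply/card_gt0P; exists j; by rewrite !inE.
move=> /card_gt0P[a]; rewrite !inE => /and3P[aF' /eqP tla hda].
pose pos' i := if i == j then hd a else pos i.
have r' : routable (F' :\ a) pos'.
  apply/routableP => U hU; have := routableP _ _ Fr' U hU.
  have := @critical_enter F' pos a U (conj Fr' Fc') aF' hU.
  rewrite (outD1 U aF') tla.
  have -> : load pos U = (pos j \in U) + \sum_(i | i != j) (pos i \in U).
    by rewrite load_sum (bigD1 j).
  have -> : load pos' U = (hd a \in U) + \sum_(i | i != j) (pos i \in U).
    rewrite load_sum (bigD1 j) //= /pos' eqxx; congr (_ + _).
    by apply: eq_bigr => i /negPf ->.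
  by case: (pos j \in U); case: (hd a \in U) => //= H1 H2; try lia;
     have := H1 isT isT; lia.
have [|p [p1 p2 p3 p4]] := IH _ _ _ r'.
  have := subset_leq_card sF'; move: ltn; rewrite (cardsD1 a F') aF'; lia.
have aNp i : a \notin p i.
  by apply/negP => /p2; rewrite !inE eqxx.
exists (fun i => if i == j then a :: p j else p i); split=> i.
- have := p1 i; rewrite /pos'; case: eqP => // -> H; split=> //.
- move=> c; case: eqP => _; last by move=> /p2; rewrite inE => /andP[_ /(subsetP sF')].
  rewrite inE => /orP[/eqP -> | /p2]; first exact: (subsetP sF').
  by rewrite inE => /andP[_ /(subsetP sF')].
- by case: eqP => //= _; rewrite aNp p3.
- move=> k c; case: (eqVneq i j) => [->|ij]; case: (eqVneq k j) => [->|kj] //.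
  + rewrite inE => /orP[/eqP -> | ]; first by rewrite (negPf (aNp k)).
    exact: p4.
  + move=> ci; rewrite inE => /orP[/eqP ca | ]; last exact: p4.
    by move: ci; rewrite ca (negPf (aNp i)).
  + exact: p4.
Qed.

End Routing.

(** * Cuts *)

Section Cuts.
Variable G : mgraph.
Implicit Types (S U : {set vert G}) (u v : vert G).

Definition crosses S U u v :=
  [&& u \notin S, v \notin S & (u \in U) != (v \in U)].
Definition cut S U := #|[set e : edge G | crosses S U (src e) (tgt e)]|.
(* [linked S c u v]: no edge cut of [G - S] of size less than [c] separates [u]
   from [v]. *)
Definition linked S c u v : bool :=
  [forall U : {set vert G}, (u \in U) && (v \notin U) ==> (c <= cut S U)].

Lemma crossesC S U u v : crosses S U u v = crosses S U v u.
Proof. by rewrite /crosses andbCA eq_sym. Qed.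

Lemma cut_sum S U : cut S U = \sum_(e : edge G) crosses S U (src e) (tgt e).
Proof.
rewrite /cut -sum1_card big_mkcond /=.
by apply: eq_bigr => e _; rewrite inE; case: crosses.
Qed.

Lemma linkedP S c u v :
  reflect (forall U, u \in U -> v \notin U -> c <= cut S U) (linked S c u v).
Proof.
apply: (iffP forallP) => H U; first by move=> uU vU; apply: (implyP (H U)); rewrite uU.
by apply/implyP => /andP[]; apply: H.
Qed.

Lemma linkedPn S c u v :
  reflect (exists U, [/\ u \in U, v \notin U & cut S U < c]) (~~ linked S c u v).
Proof.
apply: (iffP forallPn) => -[U].
  by rewrite negb_imply -ltnNge => /andP[/andP[? ?] ?]; exists U.
by case=> uU vU lt; exists U; rewrite negb_imply uU vU -ltnNge.
Qed.

Lemma crosses_sym_le S U S1 U1 S2 U2 :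
    (forall u v, u \in U -> v \notin U -> u \notin S -> v \notin S ->
       crosses S1 U1 u v || crosses S2 U2 u v) ->
  forall u v, crosses S U u v -> crosses S1 U1 u v || crosses S2 U2 u v.
Proof.
move=> H u v /and3P[uS vS]; case uU: (u \in U); case vU: (v \in U) => // _.
  by apply: H; rewrite ?uU ?vU.
by rewrite crossesC [crosses S2 _ _ _]crossesC; apply: H; rewrite ?uU ?vU.
Qed.

Lemma cut_le2 S U S1 U1 S2 U2 :
    (forall u v, u \in U -> v \notin U -> u \notin S -> v \notin S ->
       crosses S1 U1 u v || crosses S2 U2 u v) ->
  cut S U <= cut S1 U1 + cut S2 U2.
Proof.
move=> /crosses_sym_le H; rewrite !cut_sum -big_split; apply: leq_sum => e _ /=.
by have := H (src e) (tgt e); case: crosses => // /(_ isT); do 2 case: crosses.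
Qed.

Lemma cut_le1 S U S1 U1 :
    (forall u v, u \in U -> v \notin U -> u \notin S -> v \notin S ->
       crosses S1 U1 u v) ->
  cut S U <= cut S1 U1.
Proof.
move=> H; rewrite !cut_sum; apply: leq_sum => e _.
have := @crosses_sym_le S U S1 U1 S1 U1 _ (src e) (tgt e); rewrite orbb.
case: crosses => // ->; rewrite // => u v *; rewrite orbb; exact: H.
Qed.

Lemma cutC S U : cut S (~: U) = cut S U.
Proof.
rewrite !cut_sum; apply: eq_bigr => e _; rewrite /crosses !inE.
by case: (_ \in U); case: (_ \in U).
Qed.

Lemma linked_sym S c u v : linked S c u v = linked S c v u.
Proof.
by apply/linkedP/linkedP => H U uU vU; rewrite -cutC; apply: H; rewrite !inE ?negbK.
Qed.

Lemma linked_trans S c v u w : linked S c u v -> linked S c v w -> linked S c u w.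
Proof.
move=> /linkedP H1 /linkedP H2; apply/linkedP => U uU wU.
by case vU: (v \in U); [apply: H2 | apply: H1; rewrite ?vU].
Qed.

Lemma linked_le S c d u v : d <= c -> linked S c u v -> linked S d u v.
Proof.
by move=> dc /linkedP H; apply/linkedP => U *; apply: leq_trans dc _; apply: H.
Qed.

Lemma linked_refl S c u : linked S c u u.
Proof. by apply/linkedP => U ->. Qed.

End Cuts.

(** * Cycles in subgraphs *)

Section Cycles.
Variable G : mgraph.
Implicit Types (E : {set edge G}) (S : subgraph G) (u v w : vert G).

Definition adj_in E : rel (vert G) := fun u v => [exists e in E, joins e u v].

Lemma joinsC (e : edge G) u v : joins e u v = joins e v u.
Proof. by rewrite /joins orbC. Qed.

Lemma adj_in_sym E : connect_sym (adj_in E).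
Proof.
apply: sym_connect_sym => u v; rewrite /adj_in.
by apply: eq_existsb => e; rewrite joinsC.
Qed.

Lemma joins_ends (e : edge G) u v u' v' :
  joins e u v -> joins e u' v' -> (u = u' /\ v = v') \/ (u = v' /\ v = u').
Proof.
by rewrite /joins => /orP[]/andP[/eqP ? /eqP ?] /orP[]/andP[/eqP ? /eqP ?]; subst; auto.
Qed.

Lemma joins_sverts S (e : edge G) u v :
  e \in sedges S -> joins e u v -> u \in sverts S.
Proof.
move=> eS; have /andP[? ?] := implyP (forallP (sedgesP S) e) eS.
by rewrite /joins => /orP[]/andP[/eqP su /eqP tu]; subst.
Qed.

Lemma cycle_through S x u w :
    x \in sedges S -> joins x u w -> u != w ->
    connect (adj_in (sedges S :\ x)) w u ->
  contains_cycle_through S u.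
Proof.
set E := sedges S :\ x => xS xuw uw /connectP[p0 pp0 lastp0].
have [p [pp lastp Up]] : exists p, [/\ path (adj_in E) w p, u = last w p & uniq (w :: p)].
  by move: lastp0; case/shortenP: pp0 => p pp Up _ ->; exists p.
pose s := w :: p; pose k := size s.
pose X (i : 'I_k) := nth w s i.
have ne i : i.+1 < k -> exists2 e, e \in E & joins e (nth w s i) (nth w s i.+1).
  by move=> ik; have /exists_inP := pathP w pp i ik.
(* The last index receives [x], which joins the end [u] of the path to its start [w]. The default of
   [odflt] is never taken, by [ne]. *)
pose Y (i : 'I_k) := if i.+1 < k then
  odflt x [pick e in E | joins e (nth w s i) (nth w s i.+1)] else x.
have Yin (i : 'I_k) : i.+1 < k -> Y i \in E /\ joins (Y i) (X i) (nth w s i.+1).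
  move=> ik; rewrite /Y ik; case: pickP => [e /andP[]//|no].
  by have [e eE je] := ne _ ik; have := no e; rewrite /= eE je.
have Yx (i : 'I_k) : ~~ (i.+1 < k) -> Y i = x by rewrite /Y => /negPf ->.
have k2 : 1 < k.
  by rewrite /k /s; case: (p) lastp uw => //= ->; rewrite eqxx.
have YS i : Y i \in sedges S.
  have [ik|ik] := boolP (i.+1 < k); last by rewrite Yx.
  by have [] := Yin i ik; rewrite inE => /andP[].
have Yj i : joins (Y i) (X i) (X (ordS i)).
  have [ik|ik] := boolP (i.+1 < k).
    by have [_] := Yin i ik; rewrite /X /ordS /= modn_small.
  have ei : (i : nat) = k.-1 by have := ltn_ord i; move: ik; lia.
  rewrite Yx // /X /ordS /= ei prednK 1?ltnW // modnn /=.
  by rewrite -/(nth w (w :: p) _) nth_last /= -lastp.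
have Xi : injective X.
  move=> i j /eqP; rewrite /X nth_uniq //; first by move/eqP/val_inj.
have Yi : injective Y.
  move=> i j eY; apply: val_inj => /=.
  have [ik|ik] := boolP (i.+1 < k); have [jk|jk] := boolP (j.+1 < k).
  - have [_ J1] := Yin i ik; have [_ J2] := Yin j jk; rewrite eY in J1.
    case: (joins_ends J1 J2) => -[/eqP + /eqP]; rewrite /X !nth_uniq //; try exact: ltnW.
    + by move=> /eqP.
    + by move=> /eqP ? /eqP ?; lia.
  - by have [+ _] := Yin i ik; rewrite eY (Yx j jk) !inE eqxx.
  - by have [+ _] := Yin j jk; rewrite -eY (Yx i ik) !inE eqxx.
  - by have := ltn_ord i; have := ltn_ord j; move: ik jk; lia.
have CP : [forall e in [set Y i | i : 'I_k],
    (src e \in [set X i | i : 'I_k]) && (tgt e \in [set X i | i : 'I_k])].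
  apply/forall_inP => e /imsetP[i _ ->].
  by have := Yj i; rewrite /joins => /orP[]/andP[/eqP -> /eqP ->]; rewrite !imset_f.
exists (Subgraph CP); split=> /=.
- by exists k, X, Y; split=> //; apply: ltnW.
- by apply/subsetP => v /imsetP[i _ ->]; apply: joins_sverts (YS i) (Yj i).
- by apply/subsetP => v /imsetP[i _ ->].
- apply/imsetP; have kk : k.-1 < k by rewrite prednK // ltnW.
  by exists (Ordinal kk) => //; rewrite /X /= nth_last /= lastp.
Qed.

End Cycles.

(** * Immersions through a hub *)

Section Hub.
Variables (F G : mgraph) (thv : vert F -> vert G) (h : vert G).
Implicit Types U : {set vert G}.
Hypothesis thvI : injective thv.
Let Z := [set thv v | v : vert F].
Hypothesis hZ : h \notin Z.
Hypothesis link :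
  forall v, linked (Z :\ thv v) #|{: edge F * bool}| (thv v) h.

Local Notation arc := (edge G * bool)%type.
Let tl (a : arc) := if a.2 then tgt a.1 else src a.1.
Let hd (a : arc) := if a.2 then src a.1 else tgt a.1.
(** Each edge of [F] carries two tokens, one per end. Arcs into branch vertices are not allowed, so
    a walk meets [Z] only at its start; this makes the immersion strong. *)
Let fend (j : edge F * bool) := if j.2 then tgt j.1 else src j.1.
Let pos (j : edge F * bool) := thv (fend j).
Let allowed : {set arc} := [set a | hd a \notin Z].
Let opp (a : arc) : arc := (a.1, ~~ a.2).

(** An edge counted on the left has no end in [Z] except possibly [thv v], which lies in [U]. So its
    end outside [U] is not in [Z], and its orientation out of [U] is allowed. *)
Lemma cut_allowed (v : vert F) U : thv v \in U -> cut (Z :\ thv v) U <= out tl hd allowed U.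
Proof.
move=> vU; rewrite cut_sum out_sum.
pose W e b := if (e, b) \in allowed then
  (tl (e, b) \in U) && (hd (e, b) \notin U) : nat else 0.
have WE : \sum_(e : edge G) \sum_(b : bool) W e b = \sum_(a : arc) W a.1 a.2.
  exact: pair_bigA.
apply: (@leq_trans (\sum_(e : edge G) \sum_(b : bool) W e b)); last first.
  by rewrite WE [X in _ <= X]big_mkcond; apply: leq_sum => -[].
apply: leq_sum => e _; rewrite big_bool /W /tl /hd /= /crosses !inE /=.
have nv w : w \notin U -> w != thv v by apply: contraNneq => ->.
case sU: (src e \in U); case tU: (tgt e \in U); rewrite ?andbF //=.
  rewrite (nv (tgt e)) ?tU // /hd /=.
  by case: (tgt e \in Z); case: (src e \in Z); case: (_ == _).
rewrite (nv (src e)) ?sU // /hd /=.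
by case: (tgt e \in Z); case: (src e \in Z); case: (_ == _).
Qed.

Lemma allowed_routable : routable tl hd h allowed pos.
Proof.
apply/routableP => U hU; case: (posnP (load pos U)) => [->//|].
move=> /card_gt0P[j]; rewrite inE => jU; apply: leq_trans (cut_allowed jU).
by apply: leq_trans (linkedP _ _ _ _ (link _) _ jU hU); apply: max_card.
Qed.

Lemma walk_connect (S : subgraph G) v p :
    walk tl hd h v p -> (forall a, a \in p -> a.1 \in sedges S) ->
  connect (sub_adj S) v h /\
  forall a, a \in p -> connect (sub_adj S) (hd a) h.
Proof.
elim: p v => [|a p IH] v /=; first by move=> -> _; split=> //; exact: connect0.
move=> [<- wp] pS; have [|c1 c2] := IH _ wp.
  by move=> c cp; apply: pS; rewrite inE cp orbT.
have adj : sub_adj S (tl a) (hd a).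
  apply/exists_inP; exists a.1; first by apply: pS; rewrite mem_head.
  by rewrite /joins /tl /hd; case: (a.2); rewrite !eqxx ?orbT.
split; first exact: connect_trans (connect1 adj) c1.
by move=> c; rewrite inE => /orP[/eqP -> | /c2].
Qed.

Lemma walk_tl v p a : walk tl hd h v p -> a \in p ->
  tl a = v \/ exists2 c, c \in p & hd c = tl a.
Proof.
elim: p v => [|c p IH] v //= [<- wp]; rewrite inE => /orP[/eqP ->|ap]; first by left.
right; have [->|[d dp <-]] := IH _ wp ap; first by exists c; rewrite ?mem_head.
by exists d => //; rewrite inE dp orbT.
Qed.

Lemma hub_immersion : contains_strong_immersion G F.
Proof.
have [F1 sF1 cF1] := critical_exists allowed_routable.
have [p [pw pF pU pD]] := routing (proj1 cF1).
(* A critical set never contains both orientations of an edge: a tight set left by one would be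
   entered by the other. Hence arc-disjoint walks are edge-disjoint. *)
have oriented a : a \in F1 -> opp a \notin F1.
  move=> aF; apply/negP => oF; have [T [hT]] := critical_tight cF1 oF.
  have -> : tl (opp a) = hd a by rewrite /tl /hd /=; case: (a.2).
  have -> : hd (opp a) = tl a by rewrite /tl /hd /=; case: (a.2).
  move=> hdT tlT; rewrite leqNgt => /negP; apply.
  exact: critical_enter cF1 aF hT tlT hdT.
have hdZ j a : a \in p j -> hd a \notin Z.
  by move=> /pF/(subsetP sF1); rewrite inE.
have same i j a c : a \in p i -> c \in p j -> a.1 = c.1 -> a = c.
  case: a c => [e b] [e' b'] ai cj /= ee; rewrite -ee in cj *.
  have [->//|nb] := eqVneq b b'; have := oriented _ (pF _ _ ai).
  by rewrite /opp /= (_ : ~~ b = b') ?(pF _ _ cj) //; move: nb; case: (b); case: (b').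
pose Ev (f : edge F) := [set w : vert G | [|| w == h, w == thv (src f), w == thv (tgt f) |
  [exists b : bool, has (fun a => hd a == w) (p (f, b))]]].
pose Ee (f : edge F) := [set x | [exists b : bool, has (fun a : arc => a.1 == x) (p (f, b))]].
have EvP f b a : a \in p (f, b) -> hd a \in Ev f /\ tl a \in Ev f.
  have hE c : c \in p (f, b) -> hd c \in Ev f.
    move=> cp; rewrite inE; apply/or4P/Or44/existsP; exists b; apply/hasP.
    by exists c.
  move=> ap; split; first exact: hE.
  have [->|[c cp <-]] := walk_tl (pw _) ap; last exact: hE.
  by rewrite inE /pos /fend /=; case: (b); rewrite eqxx ?orbT.
have EP f : [forall x in Ee f, (src x \in Ev f) && (tgt x \in Ev f)].
  apply/forall_inP => x; rewrite inE => /existsP[b /hasP[a ap /eqP <-]].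
  by have := EvP _ _ _ ap; rewrite /tl /hd; case: (a.2) => -[-> ->].
have pE f b a : a \in p (f, b) -> a.1 \in Ee f.
  by move=> ap; rewrite inE; apply/existsP; exists b; apply/hasP; exists a.
exists thv, (fun f => Subgraph (EP f)); split; last first.
  move=> f v; rewrite /incident negb_or => /andP[n1 n2] /=.
  rewrite inE !negb_or !(inj_eq thvI) ![v == _]eq_sym n1 n2 /=.
  rewrite (memPn hZ) ?imset_f //=; apply/existsPn => b; apply/hasPn => a /hdZ.
  by apply: contraNneq => ->; rewrite imset_f.
split=> //.
- move=> f; pose S := Subgraph (EP f).
  have toh w : w \in Ev f -> connect (sub_adj S) w h.
    rewrite inE => /or4P[/eqP->|/eqP->|/eqP->|/existsP[b /hasP[a ap /eqP <-]]].
    + exact: connect0.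
    + by have [] := @walk_connect S _ _ (pw (f, false)) (pE f false).
    + by have [] := @walk_connect S _ _ (pw (f, true)) (pE f true).
    + by have [_ ->] := @walk_connect S _ _ (pw (f, b)) (pE f b).
  split; first by apply/set0Pn; exists h; rewrite inE eqxx.
  move=> u v /= uE vE; apply: connect_trans (toh u uE) _.
  by rewrite (adj_in_sym (sedges S)); apply: toh.
- move=> e f ef /=; rewrite -setI_eq0; apply/eqP/setP => x; rewrite !inE.
  apply/negP => /andP[/existsP[b /hasP[a ap /eqP ax]] /existsP[c /hasP[d dp /eqP dx]]].
  have ad := same _ _ _ _ ap dp (etrans ax (esym dx)); rewrite -ad in dp.
  by have [/eqP] := pD _ _ _ ap dp; rewrite (negPf ef).
- move=> f v; rewrite /incident inE => /orP[]/eqP ->; by rewrite eqxx ?orbT.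
(* Both walks of a loop start at [thv v]. The first edge of one is closed to a cycle by the rest of
   that walk and the other walk, which meet at [h] and avoid this edge. *)
- move=> f v inc lp; have sv : src f = v.
    by move: inc lp; rewrite /incident /is_loop => /orP[]/eqP <- /eqP.
  have tv : tgt f = v by rewrite -sv; apply/esym/eqP.
  have vh : thv v <> h by move=> vh; move: hZ; rewrite -vh imset_f.
  have := pw (f, false); have := pw (f, true); rewrite /pos /fend /= sv tv.
  have := pU (f, false); have := @same (f, false); have := pD (f, false) (f, true).
  have := pE f false; have := pE f true.
  have := hdZ (f, false).
  case p0: (p (f, false)) => [|a q] //= hda pE1 pE0 D sm /andP[aq Uq] w1 [tla w0].
  pose S' := Subgraph (EP f).
  have aS : a.1 \in sedges S' by apply: pE0; rewrite mem_head.
  have ja : joins a.1 (thv v) (hd a).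
    by rewrite -tla /joins /tl /hd; case: (a.2); rewrite !eqxx ?orbT.
  apply: (cycle_through (S := S') aS ja).
    by apply: contraNneq (hda a (mem_head _ _)) => <-; rewrite imset_f.
  have EP' : [forall x in Ee f :\ a.1, (src x \in Ev f) && (tgt x \in Ev f)].
    by apply/forall_inP => x /setD1P[_]; apply: (forall_inP (EP f)).
  have [|c0 _] := @walk_connect (Subgraph EP') _ _ w0.
    move=> c cq /=; rewrite in_setD1 pE0 ?inE ?cq ?orbT // andbT.
    apply: contraNneq aq => ca.
    have := sm (f, false) c a; rewrite p0 !inE cq eqxx orbT => /(_ isT isT ca).
    by move=> ca'; rewrite -ca'.
  have [|c1 _] := @walk_connect (Subgraph EP') _ _ w1.
    move=> c cp /=; rewrite in_setD1 pE1 // andbT.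
    apply/eqP => ca; have := sm (f, true) a c (mem_head _ _) cp (esym ca) => ac.
    by have := D a (mem_head _ _); rewrite ac cp => /(_ isT) [].
  apply: connect_trans c0 _; rewrite (adj_in_sym (sedges (Subgraph EP'))).
  exact: c1.
Qed.

End Hub.

(** * Crossing cuts *)

Section Crossing.
Variable G : mgraph.
Implicit Types (S U : {set vert G}) (u v w x : vert G).

Lemma cutD S U : cut S (U :\: S) = cut S U.
Proof.
rewrite !cut_sum; apply: eq_bigr => e _; rewrite /crosses !inE.
by case: (_ \in S) => //=; case: (_ \in S).
Qed.

Lemma cut_anti S S' U : S \subset S' -> cut S' U <= cut S U.
Proof.
move=> /subsetP sS; apply: cut_le1 => u v uU vU uS vS.
by rewrite /crosses uU vU (contra (sS u) uS) (contra (sS v) vS).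
Qed.

Lemma linked_antimono S (S' : {set vert G}) c u v :
  S \subset S' -> linked S' c u v -> linked S c u v.
Proof.
move=> sS /linkedP H; apply/linkedP => U uU vU.
by apply: leq_trans (H U uU vU) (cut_anti _ sS).
Qed.

Lemma linkedU1Pn S c w u v : u != w ->
  reflect (exists U, [/\ u \in U, v \notin U, w \notin U & cut (w |: S) U < c])
          (~~ linked (w |: S) c u v).
Proof.
move=> uw; apply: (iffP (linkedPn _ _ _ _)) => -[U].
  case=> uU vU lt; exists (U :\ w); rewrite !inE uw uU (negPf vU) eqxx andbF.
  split=> //; move: lt; rewrite -cutD -[cut _ (U :\ w)]cutD.
  by congr (cut _ _ < c); apply/setP => y; rewrite !inE; case: eqP; rewrite ?andbF.
by case=> uU vU _ lt; exists U.
Qed.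

Variables (S : {set vert G}) (b c : nat) (r : vert G).
Hypothesis le_bc : b + b <= c.

(** This lemma and the next two charge every edge leaving the new set to [U1] or [U2]. The only
    danger is an edge at the vertex deleted from the cut that should pay; the position of the two
    deleted vertices lets the other cut pay instead. *)
Lemma inter_point m w x (U1 U2 : {set vert G}) :
    linked S c m r -> m \in U1 -> m \in U2 -> r \notin U1 -> w != x ->
    cut (w |: S) U1 < b -> cut (x |: S) U2 < b ->
  (w \in U2) || (x \in U1).
Proof.
move=> /linkedP lm m1 m2 r1 wx lt1 lt2; rewrite -[_ || _]negbK negb_or.
apply/negP => /andP[w2 x1]; have := lm (U1 :&: U2); rewrite !inE m1 m2 (negPf r1).
move=> /(_ isT isT); apply/negP; rewrite -ltnNge.
apply: leq_ltn_trans (_ : cut (w |: S) U1 + cut (x |: S) U2 < c); last by lia.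
apply: cut_le2 => u v; rewrite /crosses !inE => /andP[u1 u2] + uS vS.
rewrite u1 u2 (negPf uS) (negPf vS) !orbF.
have -> : u != w by apply: contraNneq w2 => <-.
have -> : u != x by apply: contraNneq x1 => <-.
have [v1|v1] := boolP (v \in U1); have [v2|v2] := boolP (v \in U2) => //= _.
- by rewrite (_ : v != x) ?orbT //; apply: contraNneq x1 => <-.
- by rewrite (_ : v != w) ?orbT //; apply: contraNneq w2 => <-.
- by case: (eqVneq v w) => //= ->; rewrite wx ?orbT.
Qed.

Lemma union_point w x (U1 U2 : {set vert G}) :
    linked S c w r -> w \in U2 -> x \in U1 -> r \notin U1 -> r \notin U2 -> w != x ->
    cut (w |: S) U1 < b -> cut (x |: S) U2 < b -> False.
Proof.
move=> /linkedP lw w2 x1 r1 r2 wx lt1 lt2; have := lw (U1 :|: U2).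
rewrite !inE w2 orbT negb_or r1 r2 => /(_ isT isT); apply/negP; rewrite -ltnNge.
apply: leq_ltn_trans (_ : cut (w |: S) U1 + cut (x |: S) U2 < c); last by lia.
apply: cut_le2 => u v; rewrite /crosses !inE negb_or => + /andP[v1 v2] uS vS.
rewrite (negPf v1) (negPf v2) (negPf uS) (negPf vS) !orbF.
have -> : v != w by apply: contraNneq v2 => ->.
have -> : v != x by apply: contraNneq v1 => ->.
case: (eqVneq u w) => [->|uw] /=; first by rewrite w2 wx.
have [u1|u1 /= u2] := boolP (u \in U1) => //=; rewrite u2 andbT.
by apply: contraNneq u1 => ->.
Qed.

Lemma diff_point x d m (U1 U2 : {set vert G}) :
    linked S c x r -> x \in U1 -> r \notin U1 -> d \notin U1 -> m \notin U1 ->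
    d \in U2 -> m \notin U2 -> cut (d |: S) U1 < b -> cut (m |: S) U2 < b ->
  x \in U2.
Proof.
move=> /linkedP lx x1 r1 d1 m1 d2 m2 lt1 lt2; apply/negPn/negP => x2.
have := lx (U1 :\: U2); rewrite !inE x1 x2 (negPf r1) andbF => /(_ isT isT).
apply/negP; rewrite -ltnNge.
apply: leq_ltn_trans (_ : cut (d |: S) U1 + cut (m |: S) U2 < c); last by lia.
apply: cut_le2 => u v; rewrite /crosses !inE => /andP[u2 u1] + uS vS.
rewrite u1 (negPf u2) (negPf uS) (negPf vS) !orbF.
have -> : u != d by apply: contraNneq d1 => <-.
have -> : u != m by apply: contraNneq m1 => <-.
have [v2|v2] := boolP (v \in U2).
  by rewrite (_ : v != m) ?orbT //; apply: contraNneq m2 => <-.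
by move=> /= v1; rewrite v1 (_ : v != d) //; apply: contraNneq v2 => ->.
Qed.

End Crossing.

Lemma cut_le_sum (G : mgraph) (I : finType) (P : pred I) (S U S1 U1 : {set vert G})
    (T W : I -> {set vert G}) :
    (forall u v, u \in U -> v \notin U -> u \notin S -> v \notin S ->
       crosses S1 U1 u v || [exists i, P i && crosses (T i) (W i) u v]) ->
  cut S U <= cut S1 U1 + \sum_(i | P i) cut (T i) (W i).
Proof.
move=> H.
have sym u v : crosses S U u v ->
    crosses S1 U1 u v || [exists i, P i && crosses (T i) (W i) u v].
  move=> /and3P[uS vS]; case uU: (u \in U); case vU: (v \in U) => // _.
    by apply: H; rewrite ?uU ?vU.
  rewrite crossesC; under eq_existsb do rewrite crossesC.
  by apply: H; rewrite ?uU ?vU.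
under [X in _ + X]eq_bigr do rewrite cut_sum.
rewrite exchange_big /= !cut_sum -big_split /=; apply: leq_sum => e _.
have := sym (src e) (tgt e); case: (crosses S U) => // /(_ isT).
case: crosses => //= /existsP[i /andP[Pi ci]].
by rewrite add0n (bigD1 i) //= ci.
Qed.

Lemma edges_between_cut (G : mgraph) (U : {set vert G}) :
  #|edges_between U (~: U)| = cut set0 U.
Proof.
apply: eq_card => e; rewrite !inE /crosses !inE /=.
by case: (src e \in U); case: (tgt e \in U).
Qed.

Lemma or_nand_addb (u v : bool) : u || v -> ~ (u /\ v) -> u (+) v.
Proof. by case: u; case: v => //= _ /(_ (conj isT isT)). Qed.

Lemma index_enum_neq (T : finType) (A : {set T}) x :
  x \in A -> index x (enum A) <> #|A|.
Proof. by rewrite -mem_enum -index_mem -cardE => + eq; rewrite eq ltnn. Qed.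

Lemma index_enum_inj (T : finType) (A : {set T}) x y :
  x \in A -> y \in A -> index x (enum A) = index y (enum A) -> x = y.
Proof.
by rewrite -[x \in A]mem_enum -[y \in A]mem_enum => xA yA eq; rewrite -(nth_index x xA) eq nth_index.
Qed.

(** * Free sets *)

Section Free.
Variable G : mgraph.
Implicit Types (Z : {set vert G}) (h : vert G).

Definition free c Z h : bool :=
  (h \notin Z) && [forall z in Z, linked (Z :\ z) c z h].

Lemma freePn c Z h : h \notin Z -> ~~ free c Z h ->
  exists2 z, z \in Z & ~~ linked (Z :\ z) c z h.
Proof. by rewrite /free => ->; case/forall_inPn => z; exists z. Qed.

Lemma free_immersion (F : mgraph) c Z h :
    #|Z| = #|vert F| -> #|{: edge F * bool}| <= c -> free c Z h ->
  contains_strong_immersion G F.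
Proof.
move=> cZ le_c /andP[hZ /forall_inP fr].
pose thv (v : vert F) := enum_val (cast_ord (esym cZ) (enum_rank v)).
have thvI : injective thv.
  by move=> u v /enum_val_inj/cast_ord_inj/enum_rank_inj.
have im : [set thv v | v : vert F] = Z.
  apply/eqP; rewrite eqEcard card_imset // cZ leqnn andbT.
  by apply/subsetP => _ /imsetP[v _ ->]; apply: enum_valP.
apply: (@hub_immersion F G thv h thvI); rewrite im // => v.
by apply: linked_le le_c (fr _ _); apply: enum_valP.
Qed.

End Free.

(** * Chains of cuts around a maximum free set *)

Section MaximumFree.
Variables (G : mgraph) (W Z : {set vert G}) (h : vert G).
Variables (alpha beta b g : nat).
Hypothesis Wconn : edge_connected alpha W.
Hypotheses (ZW : Z \subset W) (hW : h \in W) (hZ : h \notin Z).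
Hypothesis Zfree : free beta Z h.
Hypothesis Zmax : forall Z' : {set vert G},
  Z' \subset W -> #|Z'| = #|Z|.+1 -> h \notin Z' -> ~~ free b Z' h.
Hypotheses (b_gt0 : 0 < b) (le_bg : b + b <= g) (le_beta : b + (g + g) <= beta).
Hypothesis le_alpha : g + #|Z| * (b + g) <= alpha.
Implicit Types (u v w x z d m : vert G) (U L : {set vert G}).

(** The value [b + g] is what remains [g] after a screening cut below [b] has been spent, as in
    [screens_linked]. *)
Definition tied z d := linked (Z :\ z) (b + g) d z.
Definition far d := ~~ linked Z g d h.
Definition screens z d w := ~~ linked (w |: (Z :\ z)) b d z.

Lemma linkedZh z : z \in Z -> linked (Z :\ z) beta z h.
Proof. by case/andP: Zfree => _ /forall_inP; apply. Qed.

(** Since [b <= g], the vertex [w] itself stays well linked to [h]; so the vertex that fails when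
    [w] joins [Z] is an old [z]. *)
Lemma near_screened w : w \in W -> w \notin Z -> w != h -> linked Z g w h ->
  exists z U, [/\ z \in Z, z \in U, h \notin U, w \notin U & cut (w |: (Z :\ z)) U < b].
Proof.
move=> wW wZ wh wl; have hw : h \notin w |: Z by rewrite !inE negb_or eq_sym wh.
have [] := freePn hw (Zmax _ _ hw); first by rewrite subUset sub1set wW.
  by rewrite cardsU1 wZ.
move=> z; rewrite !inE => /orP[/eqP ->|zZ].
  by rewrite setU1K // (linked_le _ wl) //; clear -le_bg; lia.
have wz : w != z by apply: contraNneq wZ => ->.
rewrite (_ : (w |: Z) :\ z = w |: (Z :\ z)); last first.
  by apply/setP => y; rewrite !inE; case: (eqVneq y w) => // ->; rewrite wz.
rewrite eq_sym in wz; move=> /(linkedU1Pn _ _ _ wz)[U []].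
by exists z, U.
Qed.

(** Otherwise intersect the side of [d] in a cut from [h] in [G - Z] with its sides in cuts from
    each [z] in [G - (Z :\ z)]. The result is a small cut of [G] itself, against the
    edge-connectivity of [W]: an edge from it to [z] is paid by the cut for [z], the only one of
    these in which [z] is kept. *)
Lemma far_tied d : d \in W -> d \notin Z -> far d -> exists2 z, z \in Z & tied z d.
Proof.
move=> dW dZ /linkedPn[U0 [dU hU ltU]]; apply/exists_inP; apply: contraT => /exists_inPn none.
have ex z : exists U, z \in Z -> [/\ d \in U, z \notin U & cut (Z :\ z) U < b + g].
  have [zZ|] := boolP (z \in Z); last by exists set0.
  by have [U] := linkedPn _ _ _ _ (none z zZ); exists U.
have [Y YP] := fin_all_exists ex.
case: (Wconn dW hW); exists (U0 :&: \bigcap_(z in Z) Y z); split.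
- rewrite inE dU; apply/bigcapP => z zZ; by have [] := YP z zZ.
- by rewrite inE (negPf hU).
set B := U0 :&: _.
rewrite edges_between_cut.
apply: (@leq_ltn_trans (cut Z U0 + \sum_(z in Z) cut (Z :\ z) (Y z))); last first.
  have : \sum_(z in Z) cut (Z :\ z) (Y z) <= #|Z| * (b + g).
    rewrite -sum_nat_const; apply: leq_sum => z zZ.
    by have [_ _ /ltnW] := YP z zZ.
  by clear -ltU le_alpha; lia.
have BZ u : u \in B -> u \notin Z.
  rewrite inE => /andP[_ /bigcapP uY]; apply/negP => uZ.
  by have [_ /negP] := YP u uZ; have := uY u uZ.
apply: cut_le_sum => u v uB vB _ _; have := uB; rewrite inE => /andP[u0 /bigcapP uY].
have [v0|v0] := boolP (v \in U0); have [vZ|vZ] := boolP (v \in Z); last 1 first.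
- by rewrite /crosses (BZ u uB) vZ u0 (negPf v0).
- apply/orP; right; apply/existsP; exists v; rewrite vZ /crosses !inE eqxx /=.
  by have [_ /negPf -> _] := YP v vZ; rewrite (negPf (BZ u uB)) andbF uY.
- apply/orP; right; apply/exists_inP.
  have /forall_inPn[z zZ zv] : ~~ [forall z in Z, v \in Y z].
    by apply: contra vB => /forall_inP vY; rewrite inE v0; apply/bigcapP.
  exists z => //; rewrite /crosses !inE (negPf (BZ u uB)) (negPf vZ) !andbF.
  by rewrite uY // (negPf zv).
- apply/orP; right; apply/existsP; exists v; rewrite vZ /crosses !inE eqxx /=.
  by have [_ /negPf -> _] := YP v vZ; rewrite (negPf (BZ u uB)) andbF uY.
Qed.

(** Replacing [z] by [d] and [d'] gives a larger set, which is not free. No other [y] in [Z] can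
    fail: its cut, enlarged by the far sides of [d] and [d'], would separate [y] from [h] in
    [G - (Z :\ y)] by fewer than [b + (g + g)] edges. *)
Lemma far_screens z d d' : z \in Z -> d \in W -> d \notin Z -> d' \in W -> d' \notin Z ->
  far d -> far d' -> d != d' -> screens z d d' || screens z d' d.
Proof.
wlog suff main : d d' / z \in Z -> d \in W -> d \notin Z -> d' \in W -> d' \notin Z ->
  far d -> far d' -> d != d' ->
  ~~ linked (d' |: (Z :\ z)) b d h -> screens z d d'.
  move=> zZ dW dZ dW' dZ' fd fd' dd'.
  pose Z' := d |: (d' |: (Z :\ z)).
  have nd : h != d by apply: contraNneq fd => <-; apply: linked_refl.
  have nd' : h != d' by apply: contraNneq fd' => <-; apply: linked_refl.
  have hZ' : h \notin Z' by rewrite !inE !negb_or nd nd' negb_and hZ orbT.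
  have [] := freePn hZ' (Zmax _ _ hZ').
  - rewrite !subUset !sub1set dW dW' /=; exact: subset_trans (subsetDl _ _) ZW.
  - rewrite /Z' !cardsU1 !inE (negPf dd') (negPf dZ) (negPf dZ') !andbF /=.
    by rewrite (cardsD1 z Z) zZ.
  have dZ1 : d \notin d' |: (Z :\ z) by rewrite !inE (negPf dd') (negPf dZ) andbF.
  have dZ1' : d' \notin d |: (Z :\ z).
    by rewrite !inE eq_sym (negPf dd') (negPf dZ') andbF.
  move=> y; rewrite in_setU1 => /orP[/eqP ->|].
    by rewrite /Z' setU1K // => nl; rewrite main.
  rewrite in_setU1 => /orP[/eqP ->|].
    rewrite /Z' setUCA setU1K // => nl; rewrite orbC main // 1?eq_sym //.
  rewrite !inE => /andP[yz yZ] /linkedPn[Y [yY hY ltY]].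
  have [U [dU hU ltU]] := linkedPn _ _ _ _ fd.
  have [U' [dU' hU' ltU']] := linkedPn _ _ _ _ fd'.
  pose V := (U :|: U') :\: Z.
  have := linkedP _ _ _ _ (linkedZh yZ) (Y :|: V).
  rewrite !inE yY (negPf hY) (negPf hU) (negPf hU') andbF => /(_ isT isT).
  suff : cut (Z :\ y) (Y :|: V) <= cut (Z' :\ y) Y + (cut Z U + cut Z U').
    by clear -ltY ltU ltU' le_beta; lia.
  apply: (@leq_trans (cut (Z' :\ y) Y + cut Z V)); last first.
    rewrite leq_add2l cutD; apply: cut_le2 => u v; rewrite /crosses !inE negb_or.
    by move=> /orP[->|->] /andP[/negPf -> /negPf ->] -> ->; rewrite ?orbT.
  have dV : d \in V by rewrite !inE dU dZ.
  have dV' : d' \in V by rewrite !inE dU' dZ' orbT.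
  apply: cut_le2 => u v; rewrite in_setU [v \in _ :|: _]in_setU negb_or.
  move=> uYV /andP[vY vV]; rewrite !in_setD1 !negb_and !negbK => uS vS.
  have vy : v != y by apply: contraNneq vY => ->.
  have vd : v != d by apply: contraNneq vV => ->.
  have vd' : v != d' by apply: contraNneq vV => ->.
  rewrite (negPf vy) /= in vS.
  have [uV|uV] := boolP (u \in V).
    have uZ : u \notin Z by move: uV; rewrite inE => /andP[].
    by rewrite /crosses uV (negPf vV) uZ vS orbT.
  have ud : u != d by apply: contraNneq uV => ->.
  have ud' : u != d' by apply: contraNneq uV => ->.
  rewrite (negPf uV) orbF in uYV.
  rewrite /crosses uYV (negPf vY) !inE !negb_and !negb_or !negbK ud ud' vd vd' (negPf vS) !andbF.
  by case/orP: uS => [->|/negPf ->]; rewrite ?andbF ?orbT.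
(* The set [Y] also separates [d] from [z]: otherwise [Y], enlarged by the far side of [d'], would
   separate [z] from [h], against the freeness of [Z]. *)
move=> zZ dW dZ dW' dZ' fd fd' dd' /linkedPn[Y [dY hY ltY]].
apply/linkedPn; exists Y; split=> //; apply/negP => zY.
have [U [dU hU ltU]] := linkedPn _ _ _ _ fd'.
pose V := U :\: Z.
have := linkedP _ _ _ _ (linkedZh zZ) (Y :|: V).
rewrite !inE zY (negPf hY) (negPf hU) andbF => /(_ isT isT).
suff : cut (Z :\ z) (Y :|: V) <= cut (d' |: (Z :\ z)) Y + cut Z V.
  by rewrite cutD; clear -ltY ltU le_beta; lia.
have dV' : d' \in V by rewrite !inE dU dZ'.
apply: cut_le2 => u v; rewrite in_setU [v \in _ :|: _]in_setU negb_or.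
move=> uYV /andP[vY vV]; rewrite !in_setD1 !negb_and !negbK => uS vS.
have vz : v != z by apply: contraNneq vY => ->.
have vd' : v != d' by apply: contraNneq vV => ->.
rewrite (negPf vz) /= in vS.
have [uV|uV] := boolP (u \in V).
  have uZ : u \notin Z by move: uV; rewrite inE => /andP[].
  by rewrite /crosses uV (negPf vV) uZ vS orbT.
have ud' : u != d' by apply: contraNneq uV => ->.
rewrite (negPf uV) orbF in uYV.
by rewrite /crosses uYV (negPf vY) !inE !negb_or !negb_and !negbK ud' vd' uS vS orbT.
Qed.

Lemma screens_linked z d d' : z \in Z -> d' \notin Z -> tied z d -> screens z d d' ->
  linked Z g d d'.
Proof.
move=> zZ dZ' /linkedP td /linkedPn[Y [dY zY ltY]].
apply: contraT => /linkedPn[U [dU dU' ltU]].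
have := td (Y :&: U); rewrite !inE dY dU (negPf zY) => /(_ isT isT).
suff : cut (Z :\ z) (Y :&: U) <= cut (d' |: (Z :\ z)) Y + cut Z U.
  by clear -ltY ltU; lia.
apply: cut_le2 => u v; rewrite !in_setI => /andP[uY uU] vYU uS vS.
have uz : u != z by apply: contraNneq zY => <-.
have ud : u != d' by apply: contraNneq dU' => <-.
have uZ : u \notin Z by move: uS; rewrite !inE uz.
have [vY|vY] := boolP (v \in Y).
  rewrite vY /= in vYU; have vz : v != z by apply: contraNneq zY => <-.
  have vZ : v \notin Z by move: vS; rewrite !inE vz.
  by rewrite {2}/crosses uZ vZ uU (negPf vYU) orbT.
have [vd|vd] := eqVneq v d'.
  by rewrite {2}/crosses uZ vd dZ' uU (negPf dU') orbT.
rewrite /crosses !inE (negPf ud) (negPf vd) /= uY (negPf vY).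
by move: uS vS; rewrite !inE => -> ->.
Qed.

Lemma screens_anti z d d' : z \in Z -> tied z d -> d != d' ->
  screens z d' d -> screens z d d' -> False.
Proof.
move=> zZ td dd'; have d'd : d' != d by rewrite eq_sym.
move=> /(linkedU1Pn _ _ _ d'd)[U1 [m1 z1 _ lt1]].
move=> /(linkedU1Pn _ _ _ dd')[U2 [m2 z2 _ lt2]].
apply: (union_point _ td m2 m1 z1 z2 dd' lt1 lt2).
by clear -le_bg; lia.
Qed.

Lemma screens_trans z x d m : z \in Z -> tied z x -> tied z d -> x != d -> d != m ->
  x != m -> screens z x d -> screens z d m -> screens z x m.
Proof.
move=> zZ tx td xd dm xm /(linkedU1Pn _ _ _ xd)[U1 [x1 z1 d1 lt1]].
move=> /(linkedU1Pn _ _ _ dm)[U2 [d2 z2 m2 lt2]].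
have le2 : b + b <= b + g by clear -le_bg; lia.
have [m1|m1] := boolP (m \in U1).
  by have := union_point le2 td d2 m1 z1 z2 dm lt1 lt2.
apply/(linkedU1Pn _ _ _ xm); exists U2; split=> //.
exact: (diff_point le2 tx x1 z1 d1 m1 d2 m2 lt1 lt2).
Qed.

Definition far_tied_set z := [set d in W :\: Z | far d && tied z d].

Lemma far_tied_setP z d : reflect [/\ d \in W, d \notin Z, far d & tied z d]
  (d \in far_tied_set z).
Proof. by rewrite !inE -!andbA andbCA; apply: and4P. Qed.

(** By totality, antisymmetry and transitivity, [screens z] is a linear order on the far vertices
    tied to [z]; the least one is found as the one with fewest predecessors. *)
Lemma far_least z : z \in Z -> exists m, far_tied_set z != set0 ->
  m \in far_tied_set z /\ forall d, d \in far_tied_set z -> d != m -> screens z m d.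
Proof.
move=> zZ; have [->|[e eE]] := set_0Vmem (far_tied_set z).
  by exists h; rewrite eqxx.
pose B m := [set x in far_tied_set z | (x != m) && screens z x m].
case: (arg_minnP (fun m => #|B m|) eE) => m mE min; exists m => _; split=> // d dE dm.
have [dW dZ fd td] := far_tied_setP _ _ dE; have [mW mZ fm tm] := far_tied_setP _ _ mE.
have md : m != d by rewrite eq_sym.
apply: contraT => nmd; have := far_screens zZ mW mZ dW dZ fm fd md.
rewrite (negPf nmd) /= => dm'.
suff : B d \proper B m by move/proper_card; rewrite ltnNge (min d dE).
apply/properP; split; last first.
  by exists d; rewrite !inE ?eqxx ?andbF //= dW dZ fd td dm dm'.
apply/subsetP => x; rewrite in_set => /and3P[xE xd xdS]; rewrite in_set.
have /far_tied_setP[xW xZ fx tx] := xE.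
have xm : x != m.
  by apply/eqP => xm; apply: (screens_anti zZ td dm _ dm'); rewrite -xm.
by rewrite xE xm (screens_trans zZ tx td xd dm xm xdS dm').
Qed.

Definition least_far (m : vert G -> vert G) := forall z, z \in Z -> far_tied_set z != set0 ->
  m z \in far_tied_set z /\
  forall d, d \in far_tied_set z -> d != m z -> screens z (m z) d.

Lemma least_far_exists : exists m : vert G -> vert G, least_far m.
Proof.
apply: (@fin_all_exists (vert G) (fun _ => vert G : Type) (fun z e => z \in Z ->
  far_tied_set z != set0 -> e \in far_tied_set z /\
  forall d, d \in far_tied_set z -> d != e -> screens z e d)) => z.
have [zZ|_] := boolP (z \in Z); last by exists h.
by have [e eP] := far_least zZ; exists e.
Qed.

(* The vertices of colour [index z (enum Z)] form two chains of cuts: those near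
   [h] lie between [z] and [h], the far ones between [m z] and [z]. *)
Definition chain_cut (m : vert G -> vert G) w L (c : nat) : Prop :=
  [\/ [/\ w = h, L = set0 & c = #|Z|],
      exists z, [/\ z \in Z, c = index z (enum Z), linked Z g w h &
        [/\ z \in L, h \notin L, w \notin L & cut (w |: (Z :\ z)) L < b]]
    | exists z, [/\ z \in Z, c = index z (enum Z), w \in far_tied_set z &
        w = m z /\ L = set0 \/
        [/\ m z \in L, z \notin L, w \notin L & cut (w |: (Z :\ z)) L < b]]].

Lemma cut_set0 S : cut S (set0 : {set vert G}) = 0.
Proof. by rewrite cut_sum big1 // => e _; rewrite /crosses !inE !andbF. Qed.

Lemma chain_cut_exists (m : vert G -> vert G) w :
  least_far m -> w \in W :\: Z -> exists L c, chain_cut m w L c.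
Proof.
move=> mP; rewrite inE => /andP[wZ wW].
have [->|wh] := eqVneq w h; first by exists set0, #|Z|; constructor 1.
have [wl|wf] := boolP (linked Z g w h).
  have [z [U [zZ zU hU wU lt]]] := near_screened wW wZ wh wl.
  by exists U, (index z (enum Z)); constructor 2; exists z.
have [z zZ tz] := far_tied wW wZ wf.
have wE : w \in far_tied_set z by apply/far_tied_setP.
have [|mE mS] := mP z zZ; first by apply/set0Pn; exists w.
have [wm|wm] := eqVneq w (m z).
  by exists set0, (index z (enum Z)); constructor 3; exists z; split=> //; left.
have mw : m z != w by rewrite eq_sym.
have /(linkedU1Pn _ _ _ mw)[U [mU zU wU lt]] := mS w wE wm.
by exists U, (index z (enum Z)); constructor 3; exists z; split=> //; right.
Qed.

Lemma chain_cut_small (m : vert G -> vert G) w L c : chain_cut m w L c ->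
  [/\ w \notin L, cut (w |: Z) L < b & c <= #|Z|].
Proof.
have idx z : z \in Z -> index z (enum Z) <= #|Z|.
  by move=> zZ; rewrite cardE index_size.
have sub z : cut (w |: Z) L <= cut (w |: (Z :\ z)) L.
  by apply/cut_anti/setUS/subsetDl.
case=> [[_ -> ->]|[z [zZ -> _ [_ _ wL lt]]]|[z [zZ -> _ [[_ ->]|[_ _ wL lt]]]]].
- by rewrite inE cut_set0.
- by split=> //; [apply: leq_ltn_trans (sub z) lt | apply: idx].
- by rewrite inE cut_set0; split=> //; apply: idx.
- by split=> //; [apply: leq_ltn_trans (sub z) lt | apply: idx].
Qed.

Lemma near_comparable z w x L (L' : {set vert G}) : z \in Z -> w != x -> linked Z g w h ->
    z \in L -> z \in L' -> h \notin L -> h \notin L' ->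
    cut (w |: (Z :\ z)) L < b -> cut (x |: (Z :\ z)) L' < b ->
  (w \in L') (+) (x \in L).
Proof.
move=> zZ wx lw zL zL' hL hL' ltw ltx.
have le_g : b + b <= beta by clear -le_bg le_beta; lia.
apply: or_nand_addb; first exact: (inter_point le_g (linkedZh zZ) zL zL' hL wx ltw ltx).
case=> wL' xL'; have lw' := linked_antimono (subsetDl Z [set z]) lw.
exact: (union_point le_bg lw' wL' xL' hL hL' wx ltw ltx).
Qed.

Lemma far_comparable z m w x L (L' : {set vert G}) : w != x -> tied z m -> tied z w ->
    m \in L -> m \in L' -> z \notin L -> z \notin L' ->
    cut (w |: (Z :\ z)) L < b -> cut (x |: (Z :\ z)) L' < b ->
  (w \in L') (+) (x \in L).
Proof.
move=> wx tm tw mL mL' zL zL' ltw ltx.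
have le_t : b + b <= b + g by clear -le_bg; lia.
apply: or_nand_addb; first exact: (inter_point le_t tm mL mL' zL wx ltw ltx).
by case=> wL' xL'; apply: (union_point le_t tw wL' xL' zL zL' wx ltw ltx).
Qed.

(** Near and far vertices of the same [z] share a colour, but being linked would make the far one
    near. The exclusive form is chosen because it survives replacing cuts by their complements. *)
Lemma chain_cut_comparable (m : vert G -> vert G) w x L (L' : {set vert G}) c :
  least_far m -> w != x -> linked Z g w x ->
  chain_cut m w L c -> chain_cut m x L' c -> (w \in L') (+) (x \in L).
Proof.
move=> mP wx lwx dw dx.
have idx := index_enum_neq; have idI := index_enum_inj.
case: dw dx => [[wh _ ->]|[z [zZ -> lw [zL hL wL ltw]]]|[z [zZ -> wE Lw]]].
- case=> [[xh]|[z [zZ cz _ _]]|[z [zZ cz _ _]]].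
  + by rewrite wh xh eqxx in wx.
  + by case: (idx _ _ _ zZ (esym cz)).
  + by case: (idx _ _ _ zZ (esym cz)).
- case=> [[_ _ cz]|[z' [zZ' cz lx [zL' hL' xL ltx]]]|[z' [_ _ xE _]]].
  + by case: (idx _ _ _ zZ cz).
  + have zz := idI _ _ _ _ zZ zZ' cz; rewrite -zz in zL' ltx.
    exact: near_comparable zZ wx lw zL zL' hL hL' ltw ltx.
  + have /far_tied_setP[_ _ /negP fx _] := xE; case: fx.
    by apply: linked_trans lw; rewrite linked_sym.
- case=> [[_ _ cz]|[z' [_ _ lx _]]|[z' [zZ' cz xE Lx]]].
  + by case: (idx _ _ _ zZ cz).
  + by have /far_tied_setP[_ _ /negP[]] := wE; apply: linked_trans lx.
  have zz := idI _ _ _ _ zZ zZ' cz; rewrite -zz in Lx xE.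
  case: Lw Lx => [[wm ->]|[mL zL wL ltw]] [[xm ->]|[mL' zL' xL ltx]].
  + by rewrite wm xm eqxx in wx.
  + by rewrite wm mL' inE.
  + by rewrite xm mL inE.
  have [|mE _] := mP z zZ; first by apply/set0Pn; exists w.
  have /far_tied_setP[_ _ _ tm] := mE; have /far_tied_setP[_ _ _ tw] := wE.
  exact: far_comparable wx tm tw mL mL' zL zL' ltw ltx.
Qed.

Lemma near_or_linked_least (m : vert G -> vert G) w : least_far m -> w \in W :\: Z ->
  linked Z g w h \/ exists2 z, z \in Z & linked Z g w (m z).
Proof.
move=> mP; rewrite inE => /andP[wZ wW].
have [wl|wf] := boolP (linked Z g w h); [by left | right].
have [z zZ tz] := far_tied wW wZ wf; exists z => //.
have wE : w \in far_tied_set z by apply/far_tied_setP.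
have [|mE mS] := mP z zZ; first by apply/set0Pn; exists w.
have [->|wm] := eqVneq w (m z); first exact: linked_refl.
have /far_tied_setP[_ _ _ tm] := mE.
by rewrite linked_sym; apply: (screens_linked zZ wZ tm (mS w wE wm)).
Qed.

Lemma cut_chains : exists (L : vert G -> {set vert G}) (col : vert G -> nat)
    (m : vert G -> vert G),
  [/\ forall w, w \in W :\: Z ->
         [/\ w \notin L w, cut (w |: Z) (L w) < b & col w <= #|Z|],
      forall w x, w \in W :\: Z -> x \in W :\: Z -> w != x -> linked Z g w x ->
         col w = col x -> (w \in L x) (+) (x \in L w)
    & forall w, w \in W :\: Z ->
         linked Z g w h \/ exists2 z, z \in Z & linked Z g w (m z)].
Proof.
have [m mP] := least_far_exists.
have ex w : exists L, exists c, w \in W :\: Z -> chain_cut m w L c.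
  have [wWZ|_] := boolP (w \in W :\: Z); last by exists set0, 0.
  by have [L [c Lc]] := chain_cut_exists mP wWZ; exists L, c.
have [L LP] := fin_all_exists ex; have [c cP] := fin_all_exists LP.
exists L, c, m; split=> w.
- by move/cP/chain_cut_small.
- move=> x /cP dw /cP dx wx lwx cc; rewrite -cc in dx.
  exact: chain_cut_comparable mP wx lwx dw dx.
- exact: near_or_linked_least.
Qed.

End MaximumFree.

(** * Forests of nested cuts *)

Section Optimal.
Variables (G : mgraph) (Z : {set vert G}).
Implicit Types (U K : {set vert G}) (w x : vert G).

(** The intersection inherits the deleted vertex of [U1], the union that of [U2]. Edges at [w]
    leaving the union are paid by [U2], which contains [w]; edges at [x] entering the intersection
    are paid by [U1], which misses [x]. *)
Lemma cut_submodular w x (U1 U2 : {set vert G}) :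
    w \in U2 -> w \notin U1 -> x \notin U1 -> x \notin U2 ->
  cut (w |: Z) (U1 :&: U2) + cut (x |: Z) (U1 :|: U2) <=
  cut (w |: Z) U1 + cut (x |: Z) U2.
Proof.
move=> w2 w1 x1 x2; rewrite !cut_sum -!big_split; apply: leq_sum => e _ /=.
have wx : w != x by apply: contraNneq x2 => <-.
have xw : x != w by rewrite eq_sym.
move: (src e) (tgt e) => u v; rewrite /crosses !inE.
case: (boolP (u \in Z)) => uZ; first by rewrite !orbT.
case: (boolP (v \in Z)) => vZ; first by rewrite !orbT !andbF.
rewrite !orbF.
case: (eqVneq u w) => [->|uw]; [|case: (eqVneq u x) => [->|ux]];
  (case: (eqVneq v w) => [->|vw]; [|case: (eqVneq v x) => [->|vx]]);
  rewrite ?w2 ?(negPf w1) ?(negPf x1) ?(negPf x2) ?eqxx ?(negPf wx) ?(negPf xw) //=;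
  try (case: (u \in U1) => //=); try (case: (v \in U1) => //=);
  try (case: (u \in U2) => //=); try (case: (v \in U2) => //=).
Qed.

(* Least cut, then least size, among the sets with a given trace on [K]; the second
   condition makes optimal sets nested. *)
Definition optimal K w U := forall U' : {set vert G},
  w \notin U' -> U' :&: K = U :&: K ->
  cut (w |: Z) U <= cut (w |: Z) U' /\
  (cut (w |: Z) U' <= cut (w |: Z) U -> #|U| <= #|U'|).

Lemma optimal_exists K w U : w \notin U ->
  exists U', [/\ w \notin U', U' :&: K = U :&: K, cut (w |: Z) U' <= cut (w |: Z) U
    & optimal K w U'].
Proof.
move=> wU; pose N := #|vert G|.
pose ok (U' : {set vert G}) := (w \notin U') && (U' :&: K == U :&: K).
have okU : ok U by rewrite /ok wU eqxx.
(* The factor exceeds every cardinality, so this weight is the lexicographic order by cut, then by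
   size. *)
case: (arg_minnP (fun U' : {set vert G} => cut (w |: Z) U' * N.+1 + #|U'|) okU).
move=> U' /andP[wU' /eqP tr] min.
have cN (A : {set vert G}) : #|A| < N.+1 by rewrite ltnS max_card.
have lt A : ok A -> cut (w |: Z) U' <= cut (w |: Z) A.
  move=> okA; rewrite -ltnS -(ltn_pmul2r (ltn0Sn N)).
  apply: leq_ltn_trans (leq_trans (leq_addr _ _) (min A okA)) _.
  by rewrite [X in _ < X]mulSn addnC ltn_add2r.
exists U'; split=> //; first exact: lt.
move=> A wA; rewrite tr => trA; have okA : ok A by rewrite /ok wA trA eqxx.
split; first exact: lt.
move=> leA; have := min A okA.
have -> : cut (w |: Z) A = cut (w |: Z) U' by apply/eqP; rewrite eqn_leq leA lt.
by rewrite leq_add2l.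
Qed.

(** The condition on traces makes [U1 :&: U2] a competitor of [U1] and [U1 :|: U2] a competitor of
    [U2]. Submodularity leaves both with least cuts, and least size then forces [U1 :&: U2 = U1]. *)
Lemma optimal_nested K w x (U1 U2 : {set vert G}) :
    optimal K w U1 -> optimal K x U2 -> U1 :&: K \subset U2 ->
    w \in U2 -> w \notin U1 -> x \notin U1 -> x \notin U2 ->
  U1 \subset U2.
Proof.
move=> o1 o2 /subsetP s12 w2 w1 x1 x2.
have [||_ le2] := o1 (U1 :&: U2); first by rewrite inE (negPf w1).
  apply/setP => u; rewrite !inE; case u1: (u \in U1); case uK: (u \in K); rewrite ?andbF //=.
  by have := s12 u; rewrite inE u1 uK => ->.
have [||le1 _] := o2 (U1 :|: U2); first by rewrite inE negb_or x1.
  apply/setP => u; rewrite !inE; case u2: (u \in U2); rewrite ?orbT ?orbF //=.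
  by apply/negP => uU; have := s12 u; rewrite inE uU u2 => /(_ isT).
have := cut_submodular w2 w1 x1 x2 => sm.
have le : #|U1| <= #|U1 :&: U2| by apply: le2; clear -le1 sm; lia.
have : U1 :&: U2 == U1 by rewrite eqEcard subsetIl.
by move/eqP/setIidPl.
Qed.

End Optimal.

Section Rooted.
Variables (G : mgraph) (Z K : {set vert G}) (b g M : nat) (r : vert G).
Variables (L : vert G -> {set vert G}) (col : vert G -> nat).
Hypothesis le_bg : b + b <= g.
Hypothesis rK : r \in K.
Hypothesis Klinked : forall w, w \in K -> linked Z g w r.
Hypothesis Lcut : forall w, w \in K :\ r ->
  [/\ w \notin L w, r \notin L w, cut (w |: Z) (L w) < b & col w < M].
Hypothesis Lcol : forall w x, w \in K :\ r -> x \in K :\ r -> w != x ->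
  col w = col x -> (w \in L x) || (x \in L w).
Let T := K :\ r.
Implicit Types u v w x y : vert G.

Lemma Tlinked w : w \in T -> linked Z g w r.
Proof. by rewrite inE => /andP[_]; apply: Klinked. Qed.

(** With [r] outside all cuts, union, difference and intersection yield in turn that [w \in L x] is
    antisymmetric, transitive, and linear above each vertex: a forest order on [T]. *)
Lemma forest_anti w x : w \in T -> x \in T -> w \in L x -> x \notin L w.
Proof.
move=> wT xT wx; apply/negP => xw.
have [w1 w2 w3 _] := Lcut wT; have [x1 x2 x3 _] := Lcut xT.
have nwx : w != x by apply: contraNneq x1 => e; rewrite -{1}e.
exact: (union_point le_bg (Tlinked wT) wx xw w2 x2 nwx w3 x3).
Qed.

Lemma forest_trans w x y : w \in T -> x \in T -> y \in T ->
  w \in L x -> x \in L y -> w \in L y.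
Proof.
move=> wT xT yT wx xy.
have [x1 x2 x3 _] := Lcut xT; have [y1 y2 y3 _] := Lcut yT.
exact: (diff_point le_bg (Tlinked wT) wx x2 x1 (forest_anti xT yT xy) xy y1 x3 y3).
Qed.

Lemma forest_up w x y : w \in T -> x \in T -> y \in T -> x != y ->
  w \in L x -> w \in L y -> (x \in L y) || (y \in L x).
Proof.
move=> wT xT yT xy wx wy.
have [x1 x2 x3 _] := Lcut xT; have [y1 y2 y3 _] := Lcut yT.
exact: (inter_point le_bg (Tlinked wT) wx wy x2 xy x3 y3).
Qed.

Let below w : pred (vert G) := fun u => (u \in T) && ((u == w) || (u \in L w)).
(** Nothing makes [col] monotone along the forest. The least colour occurring below a vertex is: it
    can only drop on the way up. *)
Definition chain_index w := col [arg min_(u < w | below w u) col u].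

Lemma chain_indexP w : w \in T ->
  (exists2 u, below w u & col u = chain_index w) /\
  forall u, below w u -> chain_index w <= col u.
Proof.
move=> wT; have ww : below w w by rewrite /below wT eqxx.
rewrite /chain_index; case: (arg_minnP col ww) => u bu min.
by split=> //; exists u.
Qed.

Lemma chain_index_lt w : w \in T -> chain_index w < M.
Proof.
move=> wT; have [[u /andP[uT _] <-] _] := chain_indexP wT.
by have [] := Lcut uT.
Qed.

Lemma chain_index_mono w x : w \in T -> x \in T -> w \in L x ->
  chain_index x <= chain_index w.
Proof.
move=> wT xT wx; have [[u /andP[uT uw] <-] _] := chain_indexP wT.
have [_] := chain_indexP xT; apply; rewrite /below uT.
by case/orP: uw => [/eqP ->|uw]; rewrite ?wx ?(forest_trans uT wT xT uw wx) orbT.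
Qed.

(** Equal indices give vertices of one colour below [w] and below [x]. These are equal or
    comparable, the lower one is below both [w] and [x], and [forest_up] applies. *)
Lemma chain_index_total w x : w \in T -> x \in T -> w != x ->
  chain_index w = chain_index x -> (w \in L x) || (x \in L w).
Proof.
move=> wT xT wx eqi.
have [[u /andP[uT uw] cu] _] := chain_indexP wT.
have [[v /andP[vT vx] cv] _] := chain_indexP xT.
have [y [yT yw yx]] : exists y, [/\ y \in T, (y == w) || (y \in L w) & (y == x) || (y \in L x)].
  have [uv|uv] := eqVneq u v; first by exists u; rewrite uT uw uv vx.
  have /orP[uv'|vu'] := Lcol uT vT uv (etrans cu (etrans eqi (esym cv))).
    exists u; split=> //; apply/orP; right; case/orP: vx => [/eqP <- //|vx].
    exact: forest_trans uT vT xT uv' vx.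
  exists v; split=> //; apply/orP; right; case/orP: uw => [/eqP <- //|uw].
  exact: forest_trans vT uT wT vu' uw.
case/orP: yw yx => [/eqP ->|yw] /orP[/eqP eqx|yx].
- by rewrite eqx eqxx in wx.
- by rewrite yx.
- by rewrite -eqx yw orbT.
- exact: forest_up yT wT xT wx yw yx.
Qed.

(** Optimal sets with the same traces on [K] define the same order, and turn membership into
    inclusion. *)
Lemma rooted_forest : exists (L' : vert G -> {set vert G}) (c : vert G -> nat),
  [/\ forall w, w \in K :\ r ->
        [/\ w \notin L' w, cut (w |: Z) (L' w) < b & c w < M],
      forall w x, w \in K :\ r -> x \in K :\ r -> w \in L' x ->
        L' w \subset L' x /\ c x <= c w,
      forall w x, w \in K :\ r -> x \in K :\ r -> w != x -> c w = c x ->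
        (w \in L' x) || (x \in L' w)
    & forall w, w \in K :\ r -> r \notin L' w /\ optimal Z K w (L' w)].
Proof.
have ex w : exists U : {set vert G}, w \in T -> [/\ w \notin U, U :&: K = L w :&: K,
    cut (w |: Z) U <= cut (w |: Z) (L w) & optimal Z K w U].
  have [wT|_] := boolP (w \in T); last by exists set0.
  have [wL _ _ _] := Lcut wT.
  by have [U []] := optimal_exists Z K wL; exists U.
have [L' L'P] := fin_all_exists ex.
have tr w x : w \in K -> x \in T -> (w \in L' x) = (w \in L x).
  move=> wK xT; have [_ /setP/(_ w) + _ _] := L'P x xT.
  by rewrite !inE wK !andbT.
have TK w : w \in T -> w \in K by rewrite inE => /andP[].
exists L', chain_index; split.
- move=> w wT; have [wL' _ le _] := L'P w wT; have [_ _ lt _] := Lcut wT.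
  by rewrite wL' chain_index_lt //; split=> //; apply: leq_ltn_trans le lt.
- move=> w x wT xT wx; have wx0 := wx; rewrite tr ?TK // in wx0.
  have [w1 trw _ ow] := L'P w wT; have [x1 trx _ ox] := L'P x xT.
  split; last exact: chain_index_mono wT xT wx0.
  apply: (optimal_nested ow ox) => //; last first.
    by rewrite tr ?TK //; apply: forest_anti.
  apply/subsetP => u; rewrite inE => /andP[uw uK]; rewrite tr // in uw.
  rewrite tr //; have [ur|ur] := eqVneq u r.
    by have [_ /negP] := Lcut wT; rewrite -ur uw.
  by apply: forest_trans uw wx0 => //; rewrite in_setD1 ur.
- by move=> w x wT xT wx; rewrite !tr ?TK //; apply: chain_index_total.
- move=> w wT; have [_ _ _ ow] := L'P w wT; split=> //.
  by rewrite tr //; have [] := Lcut wT.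
Qed.

End Rooted.

Lemma forest_of_chains (G : mgraph) (Z K : {set vert G}) (b g M : nat) (r : vert G)
    (L : vert G -> {set vert G}) (col : vert G -> nat) :
    b + b <= g -> r \in K -> (forall w, w \in K -> linked Z g w r) ->
    (forall w, w \in K -> [/\ w \notin L w, cut (w |: Z) (L w) < b & col w < M]) ->
    (forall w x, w \in K -> x \in K -> w != x -> col w = col x ->
       (w \in L x) (+) (x \in L w)) ->
  exists (L' : vert G -> {set vert G}) (c : vert G -> nat),
  [/\ forall w, w \in K :\ r ->
        [/\ w \notin L' w, cut (w |: Z) (L' w) < b & c w < M + M],
      forall w x, w \in K :\ r -> x \in K :\ r -> w \in L' x ->
        L' w \subset L' x /\ c x <= c w,
      forall w x, w \in K :\ r -> x \in K :\ r -> w != x -> c w = c x ->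
        (w \in L' x) || (x \in L' w)
    & forall w, w \in K :\ r -> r \notin L' w /\ optimal Z K w (L' w)].
Proof.
move=> le_bg rK lK LK comp.
(* Cuts containing the root are turned inside out. This reverses their order, so the two kinds
   receive separate colours; hence [M + M]. *)
pose L1 w := if r \in L w then ~: L w :\ w else L w.
pose col1 w := (r \in L w) * M + col w.
apply: (rooted_forest (L := L1) (col := col1) le_bg rK lK).
  move=> w; rewrite in_setD1 => /andP[wr wK]; have [w1 w2 w3] := LK w wK.
  rewrite /L1 /col1; case: ifP => rL; split; rewrite ?rL //.
  - by rewrite !inE eqxx.
  - by rewrite !inE rL andbF.
  - rewrite -cutD (_ : _ :\: _ = ~: L w :\: (w |: Z)); first by rewrite cutD cutC.
    by apply/setP => u; rewrite !inE; case: (u == w).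
  - by clear -w3; lia.
  - by clear -w3; lia.
move=> w x; rewrite !in_setD1 => /andP[wr wK] /andP[xr xK] wx; rewrite /col1 => cc.
have [_ _ w3] := LK w wK; have [_ _ x3] := LK x xK.
have xw : x != w by rewrite eq_sym.
have eqr : (r \in L w) = (r \in L x).
  by move: cc; case: (r \in L w); case: (r \in L x) => //=; clear -w3 x3; lia.
have eqc : col w = col x by move: cc; rewrite eqr; clear; lia.
have := comp w x wK xK wx eqc; rewrite /L1 eqr; case: ifP => _.
  by rewrite !inE wx xw; case: (w \in L x); case: (x \in L w).
by case: (w \in L x); case: (x \in L w).
Qed.

(** * Path-like decompositions from nested families *)

Section Nested.
Variables (T : finType) (X : {set T}) (D : T -> {set T}).
Implicit Types (N : {set T}) (x y u v : T).

Definition nested : Prop :=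
  (forall x, x \in X -> x \notin D x) /\
  (forall x y, x \in X -> y \in X -> x != y ->
     (x |: D x \subset D y) || (y |: D y \subset D x)).

(* [x] is hit when [N] meets the gap between [D x] and the next set of the family;
   the gap after the last set extends to the whole of [T]. *)
Definition hits N : {set T} :=
  [set x in X | [exists u in N, (u \notin D x) &&
                   [forall y in X, (x \in D y) ==> (u \in D y)]]].

Lemma hitsP N x : reflect
  (x \in X /\ exists u, [/\ u \in N, u \notin D x
                         & forall y, y \in X -> x \in D y -> u \in D y])
  (x \in hits N).
Proof.
rewrite inE; apply: (iffP andP) => -[xX].
  case/exists_inP => u uN /andP[uD /forall_inP H]; split=> //; exists u; split=> //.
  by move=> y yX; apply/implyP/H.
case=> u [uN uD H]; split=> //; apply/exists_inP; exists u => //.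
by rewrite uD; apply/forall_inP => y yX; apply/implyP/H.
Qed.

Hypothesis nestedXD : nested.

Lemma nested_enum : exists s : seq T, [/\ uniq s, s =i X &
  forall x0 i j, i < j < size s -> nth x0 s i |: D (nth x0 s i) \subset D (nth x0 s j)].
Proof.
case: nestedXD => _ nest.
pose le := relpre (fun x => #|D x|) leq; exists (sort le (enum X)).
have memX : sort le (enum X) =i X by move=> x; rewrite mem_sort mem_enum.
have Us : uniq (sort le (enum X)) by rewrite sort_uniq enum_uniq.
have srt : sorted le (sort le (enum X)).
  by apply: sort_sorted => x y; apply: leq_total.
have tr : transitive le by move=> y x z; apply: leq_trans.
split=> // x0 i j /andP[ij js]; have is_ := ltn_trans ij js.
have leij : le (nth x0 (sort le (enum X)) i) (nth x0 (sort le (enum X)) j).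
  by apply: (sorted_ltn_nth tr) => //; rewrite inE.
set x := nth _ _ i in leij *; set y := nth _ _ j in leij *.
have xX : x \in X by rewrite -memX mem_nth.
have yX : y \in X by rewrite -memX mem_nth.
have xy : x != y by rewrite nth_uniq // ltn_eqF.
case/orP: (nest x y xX yX xy) => // /subset_leq_card.
rewrite cardsU1; have [-> _] := (nestedXD.1 y yX, I).
by rewrite /= add1n; move: leij; rewrite /le /= => le1 le2; have := leq_trans le2 le1; rewrite ltnn.
Qed.

End Nested.

Section Layout.
Variables (H : mgraph) (X : {set vert H}) (D : vert H -> {set vert H}).
Hypothesis nestedXD : nested X D.

(** For a nested family this is the number of the bag that [v] falls into, defined without choosing
    an enumeration of [X]. *)
Let rank v := #|[set x in X | v \notin D x]|.

Lemma rank_nth s x0 i v : uniq s -> s =i X ->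
    (forall x0 i j, i < j < size s -> nth x0 s i |: D (nth x0 s i) \subset D (nth x0 s j)) ->
    i < size s ->
  (v \in D (nth x0 s i)) = (rank v <= i).
Proof.
move=> Us sX nest si.
have sub j k : j <= k < size s -> D (nth x0 s j) \subset D (nth x0 s k).
  case/andP; rewrite leq_eqVlt => /orP[/eqP -> //|jk ks].
  by apply: subset_trans (nest x0 j k _); rewrite ?subsetUr ?jk.
have -> : rank v = count (fun x => v \notin D x) s.
  rewrite /rank -size_filter -(card_uniqP _); last exact: filter_uniq.
  by apply: eq_card => x; rewrite !inE mem_filter sX andbC.
apply/idP/idP => vD.
  rewrite -(cat_take_drop i s) count_cat (_ : count _ (drop i s) = 0).
    by rewrite addn0 (leq_trans (count_size _ _)) // size_take si.
  apply/eqP; rewrite eqn0Ngt -has_count; apply/(has_nthP x0) => -[j].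
  rewrite size_drop nth_drop => js; case/negP.
  by apply: (subsetP (sub i (i + j) _)) => //; rewrite leq_addr; clear -js; lia.
apply: contraLR vD => vD; rewrite -ltnNge -(cat_take_drop i.+1 s) count_cat.
apply: leq_trans (leq_addr _ _).
have st : size (take i.+1 s) = i.+1.
  by rewrite size_take; case: ltnP => // ?; apply/eqP; rewrite eqn_leq; apply/andP.
rewrite -[X in X <= _]st leq_eqVlt eq_sym -all_count; apply/orP; left.
apply/(all_nthP x0) => j; rewrite st ltnS => ji; rewrite nth_take ?ltnS //.
by apply: contra vD; apply: (subsetP (sub j i _)); rewrite ji.
Qed.

(** A vertex of [X] in [N] is hit by itself, as it lies outside its own set. If [N] meets bag
    [j + 1], the vertex at position [j] is hit; bag 0 accounts for the final [1]. *)
Lemma layout : exists P : path_like X,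
  (forall k, (forall x, x \in X -> cut [set x] (D x) < k) -> 0 < k -> width P < k) /\
  forall N, #|X :&: N| + num_bags P N <= #|hits X D N| + #|hits X D N| + 1.
Proof.
have [s [Us sX nest]] := nested_enum nestedXD.
have [self _] := nestedXD.
pose t := size s.
have tE : #|X| = t by rewrite -(eq_card sX); apply/card_uniqP.
pose pv (i : 'I_t) := tnth (in_tuple s) i.
pose bg (j : 'I_t.+1) := [set v | (v \notin X) && (rank v == j)].
have pvX i : pv i \in X by rewrite -sX; apply: mem_tnth.
have rk i v : (v \in D (pv i)) = (rank v <= i).
  by rewrite /pv (tnth_nth (pv i)) /= rank_nth //; apply: ltn_ord.
have pvI : injective pv by apply/tuple_uniqP.
have pvim : [set pv i | i : 'I_t] = X.
  apply/setP => x; apply/imsetP/idP => [[i _ ->]//|]; rewrite -sX => xs.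
  by have /tnthP[i ->] : x \in in_tuple s by []; exists i.
have bgd i j : i != j -> [disjoint bg i & bg j].
  move=> ij; rewrite -setI_eq0; apply/eqP/setP => v; rewrite !inE.
  by apply/negP => /andP[/andP[_ /eqP ->] /andP[_ /eqP/val_inj e]]; rewrite e eqxx in ij.
have rkt v : rank v < t.+1.
  by rewrite ltnS -tE subset_leq_card //; apply/subsetP => x; rewrite inE => /andP[].
have bgc : \bigcup_(j < t.+1) bg j = ~: X.
  apply/setP => v; rewrite inE; apply/bigcupP/idP => [[j _]|vX]; first by rewrite inE => /andP[].
  by exists (Ordinal (rkt v)) => //; rewrite inE vX /= eqxx.
have nestpv (i j : 'I_t) : i < j -> pv i |: D (pv i) \subset D (pv j).
  move=> ij; rewrite /pv !(tnth_nth (pv i)) /=; apply: nest.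
  by rewrite ij; apply: (ltn_ord j).
exists (PathLike pvI pvim bgd bgc); split.
- move=> k cutk k0; rewrite /width; apply/(@leq_trans k.-1.+1); last by rewrite prednK.
  rewrite ltnS; apply/bigmax_leqP => /= i _.
  apply: (@leq_trans (cut [set pv i] (D (pv i)))); last first.
    by have := cutk _ (pvX i); case: (k) k0.
  apply: subset_leq_card; apply/subsetP => e.
  have bef v : v \in before (P := PathLike pvI pvim bgd bgc) i ->
      v \in D (pv i) /\ v != pv i.
    rewrite inE => /orP[/imsetP[j]|/bigcupP[j ji]].
      rewrite inE => ji -> /=; split; last by rewrite (inj_eq pvI) neq_ltn ji.
      by apply: (subsetP (nestpv j i ji)); rewrite inE set11.
    rewrite inE => /andP[vX /eqP rv]; rewrite rk rv; split=> //.
    by apply: contraNneq vX => ->.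
  have aft v : v \in after (P := PathLike pvI pvim bgd bgc) i ->
      v \notin D (pv i) /\ v != pv i.
    rewrite inE => /orP[/imsetP[j]|/bigcupP[j ji]].
      rewrite inE => ji -> /=; split; last by rewrite (inj_eq pvI) neq_ltn ji orbT.
      apply: contra (self _ (pvX j)); apply/subsetP.
      by apply: subset_trans (nestpv i j ji); apply: subsetUr.
    rewrite inE => /andP[vX /eqP rv]; rewrite rk rv -ltnNge; split=> //.
    by apply: contraNneq vX => ->.
  rewrite /vertex_cut /edges_between in_set => ei.
  rewrite in_set /crosses !in_set1; case/orP: ei => /andP[].
    by move=> /bef[-> ->] /aft[/negPf -> ->].
  by move=> /aft[/negPf -> ->] /bef[-> ->].
- move=> N; rewrite -addnA; apply: leq_add.
    apply: subset_leq_card; apply/subsetP => x; rewrite inE => /andP[xX xN].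
    by apply/hitsP; split=> //; exists x; split=> //; apply: self.
  pose J := [set i : 'I_t | pv i \in hits X D N].
  apply: (@leq_trans #|ord0 |: [set lift ord0 i | i in J]|).
    apply: subset_leq_card; apply/subsetP => j; rewrite !inE /= => /set0Pn[v].
    rewrite inE => /andP[]; rewrite inE => /andP[vX /eqP rv] vN.
    case: (unliftP ord0 j) rv => [i|] -> rv; last by rewrite eqxx.
    rewrite (mem_imset _ _ (@lift_inj _ ord0)); apply/orP; right.
    rewrite inE; apply/hitsP; split; first exact: pvX.
    exists v; split=> //; first by rewrite rk rv -ltnNge.
    move=> y; rewrite -pvim => /imsetP[k _ ->]; rewrite !rk rv => ik.
    rewrite /lift /= /bump leq0n add1n ltnNge; apply/negP => ki.
    have : pv i \in D (pv i).
      move: ik; rewrite -rk; move: ki; rewrite leq_eqVlt => /orP[/eqP/val_inj -> //|ki].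
      by apply/subsetP; apply: subset_trans (nestpv k i ki); apply: subsetUr.
    by apply/negP; apply: self.
  rewrite cardsU1 addnC; apply: leq_add; last by case: (_ \in _).
  rewrite (leq_trans (leq_imset_card _ _)) // -(card_imset _ pvI).
  by apply: subset_leq_card; apply/subsetP => x /imsetP[i]; rewrite inE => iJ ->.
Qed.

End Layout.

(** * Transfer of a nested family to the graph without [A] *)

Section DeleteVertices.
Variables (G : mgraph) (A W : {set vert G}) (D : vert G -> {set vert G}).
Let H := del_verts A.
Let X : {set vert H} := restr A (W :\: A).
Let D' (x : vert H) : {set vert H} := restr A (D (val x)).

Lemma in_restr (Z : {set vert G}) (v : vert H) : (v \in restr A Z) = (val v \in Z).
Proof. by rewrite inE. Qed.

Lemma cut_restr (x : vert H) (U : {set vert G}) :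
  cut [set x] (restr A U) <= cut (val x |: A) U.
Proof.
rewrite /cut -(card_imset _ (@val_inj _ _ (edge H))).
apply: subset_leq_card; apply/subsetP => e /imsetP[e' + ->].
rewrite !inE /crosses !in_set1 !in_restr !in_setU1.
have /andP[sA tA] := valP e'; rewrite (negPf sA) (negPf tA) !orbF.
by rewrite -!val_eqE.
Qed.

Lemma nested_restr : nested (W :\: A) D -> nested X D'.
Proof.
case=> self nest; split=> [x|x y]; rewrite !in_restr; first exact: self.
move=> xX yX; rewrite -val_eqE => /(nest _ _ xX yX).
have sub u v : u |: D u \subset D v -> forall u' v' : vert H, val u' = u -> val v' = v ->
    u' |: D' u' \subset D' v'.
  move=> /subsetP s u' v' eu ev; rewrite -eu -ev in s; apply/subsetP => w.
  rewrite in_setU1 !in_restr => ww; apply: s; rewrite in_setU1.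
  by case/orP: ww => [/eqP ->|->]; rewrite ?eqxx ?orbT.
by case/orP=> /sub s; rewrite (s _ _ erefl erefl) ?orbT.
Qed.

Lemma hits_restr (N : {set vert G}) :
  #|hits X D' (restr A N)| <= #|hits (W :\: A) D (N :\: A)|.
Proof.
rewrite -(card_imset _ (@val_inj _ _ (vert H))); apply: subset_leq_card.
apply/subsetP => x /imsetP[x' /hitsP[+ [u [+ + uD]]] ->].
rewrite !in_restr => xX uN ux; apply/hitsP; split=> //; exists (val u); split=> //.
  by rewrite inE uN (valP u).
move=> y yX xy; have yA : y \notin A by move: yX; rewrite inE => /andP[].
by have := uD (Sub y yA); rewrite !in_restr SubK => /(_ yX xy).
Qed.

Lemma linear_of_nested alpha : 0 < alpha -> A \subset W -> #|A| <= alpha ->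
    nested (W :\: A) D ->
    (forall x, x \in W :\: A -> cut (x |: A) (D x) < alpha) ->
    (forall a, a \in A ->
       #|hits (W :\: A) D (neighborhood a :\: A)| +
       #|hits (W :\: A) D (neighborhood a :\: A)| + 1 <= alpha) ->
  linear alpha W.
Proof.
move=> al0 AW cA nst ctD hit; exists A; split=> //.
have [P [wP hP]] := layout (nested_restr nst); exists P; split.
  apply: wP => // x; rewrite in_restr => xX; apply: leq_ltn_trans (ctD _ xX).
  exact: cut_restr.
move=> a aA; apply: leq_trans (hP _) (leq_trans _ (hit a aA)).
by rewrite leq_add2r leq_add ?hits_restr.
Qed.

End DeleteVertices.

(** * Vertices with neighbours in many gaps *)

Section Gaps.
Variables (G : mgraph) (Z : {set vert G}).
Implicit Types (S U Y N : {set vert G}) (a u v w x y p q : vert G).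

Lemma neighborhoodP a u : reflect (exists e : edge G, joins e a u) (u \in neighborhood a).
Proof. by rewrite inE; apply: existsP. Qed.

Lemma card_crossing_neighbors S U a N : N \subset neighborhood a ->
  (forall u, u \in N -> crosses S U a u) -> #|N| <= cut S U.
Proof.
move=> /subsetP Na cr; pose other e := if src e == a then tgt e else src e : vert G.
apply: leq_trans (leq_imset_card other [set e : edge G | crosses S U (src e) (tgt e)]).
apply/subset_leq_card/subsetP => u uN; have /neighborhoodP[e je] := Na u uN.
apply/imsetP; exists e; rewrite ?in_set /other.
  by have := cr u uN; case/orP: je => /andP[/eqP -> /eqP ->] //; rewrite crossesC.
by case/orP: je => /andP[/eqP -> /eqP ->]; rewrite ?eqxx //; case: eqP => // ->.
Qed.

Lemma gap_choice Y (L : vert G -> {set vert G}) N : nested Y L -> Y \subset hits Y L N ->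
  exists f : vert G -> vert G,
    [/\ forall y, y \in Y -> f y \in N, forall y, y \in Y -> f y \notin L y,
        forall y y', y \in Y -> y' \in Y -> y \in L y' -> f y \in L y'
      & {in Y &, injective f}].
Proof.
move=> [self nest] /subsetP Yh.
have ex y : exists u, y \in Y ->
    [/\ u \in N, u \notin L y & forall y', y' \in Y -> y \in L y' -> u \in L y'].
  have [yY|_] := boolP (y \in Y); last by exists y.
  by have /hitsP[_ [u uP]] := Yh y yY; exists u.
have [f fP] := fin_all_exists ex; exists f; split.
- by move=> y /fP[].
- by move=> y /fP[].
- by move=> y y' /fP[_ _ H]; apply: H.
move=> y y' yY yY' eqf; apply/eqP; apply: contraT => yy.
have [_ ny H] := fP y yY; have [_ ny' H'] := fP y' yY'.
case/orP: (nest y y' yY yY' yy) => /subsetP s.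
  by move: ny'; rewrite -eqf H // s // in_setU1 eqxx.
by move: ny; rewrite eqf H' // s // in_setU1 eqxx.
Qed.

Lemma nested_max Y (L : vert G -> {set vert G}) : nested Y L -> Y != set0 ->
  exists2 y, y \in Y & forall y', y' \in Y -> y' != y -> y' |: L y' \subset L y.
Proof.
move=> [self nest] /set0Pn[y0 y0Y].
case: (arg_maxnP (fun y => #|L y|) y0Y) => y yY mx; exists y => // y' yY' yy.
case/orP: (nest y' y yY' yY yy) => // /subset_leq_card.
by rewrite cardsU1 self //= add1n ltnNge (mx y' yY' : #|L y'| <= #|L y|).
Qed.

Lemma nested_min Y (L : vert G -> {set vert G}) : nested Y L -> Y != set0 ->
  exists2 y, y \in Y & forall y', y' \in Y -> y' != y -> y |: L y \subset L y'.
Proof.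
move=> [self nest] /set0Pn[y0 y0Y].
case: (arg_minnP (fun y => #|L y|) y0Y) => y yY mn; exists y => // y' yY' yy.
rewrite eq_sym in yy.
case/orP: (nest y y' yY yY' yy) => // /subset_leq_card.
by rewrite cardsU1 self //= add1n ltnNge mn.
Qed.

Lemma nested_sub (X : {set vert G}) Y (L : vert G -> {set vert G}) :
  Y \subset X -> nested X L -> nested Y L.
Proof.
move=> /subsetP YX [self nest]; split; first by move=> x /YX/self.
by move=> x y /YX xX /YX yX; apply: nest.
Qed.

(** Split [Y] by whether [L y] contains [a]. Where it does not, the largest such set contains the
    chosen neighbours from all other gaps; where it does, the smallest misses them. Either way the
    edges from [a] to them cross a single cut. *)
Lemma gaps_outside Y (L : vert G -> {set vert G}) b a N :
    nested Y L -> Y \subset hits Y L N -> N \subset neighborhood a :\: Z ->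
    [disjoint Y & Z] -> a \notin Z -> a \notin Y ->
    (forall y, y \in Y -> cut (y |: Z) (L y) < b) ->
  #|Y| <= b + b.
Proof.
move=> nst Yh /subsetP Na YZ aZ aY ctb.
have [f [fN fL fLL fI]] := gap_choice nst Yh.
have bnd (B : {set vert G}) y : B \subset Y -> y \in Y ->
    (forall z, z \in B -> z != y -> crosses (y |: Z) (L y) a (f z)) -> #|B| <= b.
  move=> /subsetP BY yY cr; have := ctb y yY; apply: leq_trans.
  apply: (@leq_trans #|B :\ y|.+1); first by rewrite (cardsD1 y B) -add1n leq_add2r leq_b1.
  rewrite ltnS -(card_in_imset (f := f)); last first.
    by move=> u v /setD1P[_ /BY uY] /setD1P[_ /BY vY]; apply: fI.
  apply: (@card_crossing_neighbors _ _ a).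
    apply/subsetP => _ /imsetP[z /setD1P[_ /BY zY] ->].
    by have := Na _ (fN z zY); rewrite inE => /andP[].
  by move=> _ /imsetP[z /setD1P[zy zB] ->]; apply: cr.
have yZ y : y \in Y -> y \notin Z by move=> yY; rewrite (disjointFr YZ).
have fZ y : y \in Y -> f y \notin Z.
  by move=> yY; have := Na _ (fN y yY); rewrite inE => /andP[].
have ya y : y \in Y -> a != y by move=> yY; apply: contraNneq aY => ->.
pose A := [set y | a \in L y].
rewrite -(cardsID A Y) addnC; apply: leq_add.
  have [->|ne] := eqVneq (Y :\: A) set0; first by rewrite cards0.
  have [y yYA mx] := nested_max (nested_sub (subsetDl _ _) nst) ne.
  have [yY ay] : y \in Y /\ a \notin L y by move: yYA; rewrite !inE => /andP[].
  apply: (bnd _ y (subsetDl _ _) yY) => z zYA zy; have [zY _] := setDP zYA.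
  have fy : f z \in L y.
    by apply: fLL => //; apply: (subsetP (mx z zYA zy)); rewrite in_setU1 eqxx.
  rewrite /crosses !in_setU1 !negb_or aZ fZ // ya // (negPf ay) fy !andbT /=.
  by apply: contraNneq (nst.1 y yY) => e; rewrite -{1}e.
have [->|ne] := eqVneq (Y :&: A) set0; first by rewrite cards0.
have [y yYA mn] := nested_min (nested_sub (subsetIl _ _) nst) ne.
have [yY ay] : y \in Y /\ a \in L y by move: yYA; rewrite !inE => /andP[].
apply: (bnd _ y (subsetIl _ _) yY) => z zYA zy; have [zY _] := setIP zYA.
have /subsetP yz := mn z zYA zy; have fz := fL z zY.
have fy : f z \notin L y by apply: contra fz => fy; apply: yz; rewrite in_setU1 fy orbT.
rewrite /crosses !in_setU1 !negb_or aZ fZ // ya // ay (negPf fy) !andbT /=.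
by apply: contraNneq fz => ->; apply: yz; rewrite in_setU1 eqxx.
Qed.

End Gaps.

(** Here the charge may use the edge itself: the set [Q] in [gap_marker] is controlled only through
    the edges that leave it. *)
Lemma cut_le2_edge (G : mgraph) (S U S1 U1 S2 U2 : {set vert G}) :
    (forall e p q, joins e p q -> p \in U -> q \notin U -> p \notin S -> q \notin S ->
       crosses S1 U1 p q || crosses S2 U2 p q) ->
  cut S U <= cut S1 U1 + cut S2 U2.
Proof.
move=> H; rewrite !cut_sum -big_split; apply: leq_sum => e _ /=.
case cr: (crosses S U (src e) (tgt e)) => //.
suff : crosses S1 U1 (src e) (tgt e) || crosses S2 U2 (src e) (tgt e).
  by case: crosses => //= ->; rewrite ?addn1.
move: cr; rewrite /crosses => /and3P[sS tS].
have j1 : joins e (src e) (tgt e) by rewrite /joins !eqxx.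
have j2 : joins e (tgt e) (src e) by rewrite joinsC.
case sU: (src e \in U); case tU: (tgt e \in U) => // _.
  by apply: (H _ _ _ j1); rewrite ?sU ?tU.
by rewrite -/(crosses S1 U1 _ _) -/(crosses S2 U2 _ _) crossesC
  [crosses S2 _ _ _]crossesC; apply: (H _ _ _ j2); rewrite ?sU ?tU.
Qed.

(** * One gap, seen from a vertex of [Z] *)

Section HubStep.
Variables (G : mgraph) (Z K : {set vert G}) (b g k : nat) (a r : vert G).
Variables (L : vert G -> {set vert G}).
Implicit Types (S U : {set vert G}) (u v w x y p q : vert G).
Hypothesis le_g : k + (b + b) <= g.
Hypothesis aZ : a \in Z.
Hypothesis Klinked : forall w, w \in K -> linked Z g w r.
Hypothesis Lcut : forall w, w \in K :\ r -> w \notin L w /\ cut (w |: Z) (L w) < b.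
Hypothesis Lopt : forall w, w \in K :\ r -> r \notin L w /\ optimal Z K w (L w).

(* The end of a crossing edge that tells in which gap the edge lies. *)
Definition marker U (e : edge G) : vert G :=
  if src e \in U then (if tgt e == a then src e else tgt e)
  else (if src e == a then tgt e else src e).

Lemma markerE U e p q : joins e p q -> p \in U -> q \notin U ->
  marker U e = if q == a then p else q.
Proof.
by rewrite /marker; case/orP=> /andP[/eqP -> /eqP ->] pU qU; rewrite ?pU ?(negPf qU).
Qed.

Lemma crosses_joins S U e p q : joins e p q ->
  crosses S U (src e) (tgt e) = crosses S U p q.
Proof. by case/orP=> /andP[/eqP -> /eqP ->] //; rewrite crossesC. Qed.

Variables (w x : vert G).
Hypotheses (wK : w \in K :\ r) (xK : x \in K :\ r).
Hypotheses (wx : w \in L x) (sLwx : L w \subset L x).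

(** Otherwise [(U :&: L x) :|: L w] separates [w] from [x] in [G - Z], although both are linked to
    [r]. Its edges are paid by [U] when they stay in the gap or end at [x], and by the cuts of [w]
    and [x] otherwise; so [S] only has to avoid the gap and [x]. *)
Lemma gap_linked S U : w \in U -> x \notin S ->
    (forall p, p \in L x -> p \notin L w -> p \notin S) -> cut S U < k ->
  x \in U.
Proof.
move=> wU xS pS lt; apply: contraT => xU.
have [w1 w2] := Lcut wK; have [x1 x2] := Lcut xK.
have lk : linked Z g w x.
  have [_ wK'] := setD1P wK; have [_ xK'] := setD1P xK.
  by apply: linked_trans (Klinked wK') _; rewrite linked_sym Klinked.
have := linkedP _ _ _ _ lk ((U :&: L x) :|: L w).
rewrite !inE wU wx (negPf xU) /= (contra (subsetP sLwx x) x1) => /(_ isT isT).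
apply: contraTT => _; rewrite -ltnNge.
have wUL : w \in (U :&: L x) :|: L w by rewrite !inE wU wx.
suff : cut Z ((U :&: L x) :|: L w) <= cut S U + (cut (w |: Z) (L w) + cut (x |: Z) (L x)).
  by clear -lt w2 x2 le_g; lia.
rewrite addnA.
have := @cut_le_sum G bool predT Z ((U :&: L x) :|: L w) S U
  (fun c => if c then w |: Z else x |: Z) (fun c => if c then L w else L x).
rewrite big_bool /= -addnA; apply => p q + qU pZ qZ.
have qw : q != w by apply: contraNneq qU => ->.
move: qU; rewrite !in_setU !in_setI negb_or negb_and => /andP[qUL qw'] pUL.
have [pw|pw] := boolP (p \in L w).
  apply/orP; right; apply/existsP; exists true.
  rewrite /= /crosses !in_setU1 (negPf qw) (negPf pZ) (negPf qZ) pw (negPf qw') !orbF /=.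
  by rewrite andbT; apply: contraNneq w1 => e; rewrite -{1}e.
rewrite (negPf pw) orbF in pUL; have /andP[pU px] := pUL.
have [qx|qx] := boolP (q \in L x).
  rewrite qx orbF in qUL; apply/orP; left.
  by rewrite /crosses pU (negPf qUL) (pS p px pw) (pS q qx qw').
have [eqx|qx'] := eqVneq q x.
  by rewrite eqx /crosses pU (negPf xU) (pS p px pw) xS.
apply/orP; right; apply/existsP; exists false.
rewrite /= /crosses !in_setU1 (negPf qx') (negPf pZ) (negPf qZ) px (negPf qx) !orbF /=.
by rewrite andbT; apply: contraNneq x1 => e; rewrite -{1}e.
Qed.

(* If no edge of the cut [U] is marked in the gap, the part [Q] of the gap outside
   [U] is joined only to [L w] and to the vertices beyond [x]; moving [Q] out of
   [L x] or into [L w] then contradicts optimality. *)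
Lemma gap_marker S U u : w \in U -> x \in U -> w \notin S -> x \notin S ->
    (forall p, p \in L x -> p \notin L w -> p \notin S) ->
    a \notin S -> a \notin U -> u \in L x -> u \notin L w -> u \notin Z ->
    u \in neighborhood a ->
  exists2 e, crosses S U (src e) (tgt e) & marker U e \in L x :\: L w.
Proof.
move=> wU xU wS xS pS aS aU ux uw uZ /neighborhoodP[e0 je0].
have [uU|uU] := boolP (u \in U).
  exists e0; first by rewrite (crosses_joins _ _ je0) crossesC /crosses aS uU (negPf aU) pS.
  by rewrite joinsC in je0; rewrite (markerE je0 uU aU) eqxx inE uw ux.
pose Q := (L x :\: L w) :\: U :\: Z.
have [/existsP[e /andP[]]|/existsPn none] := boolP [exists e : edge G,
  crosses S U (src e) (tgt e) && (marker U e \in L x :\: L w)]; first by exists e.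
have [w1 w2] := Lcut wK; have [x1 x2] := Lcut xK.
have QP p : p \in Q -> [/\ p \in L x, p \notin L w, p \notin U & p \notin Z].
  by rewrite !inE => /and4P[].
have noQ e p q : joins e p q -> p \in U -> p \notin S -> q \notin Q.
  move=> je pU pS'; apply/negP => /QP[qx qw qU qZ].
  have := none e; rewrite (crosses_joins _ _ je) /crosses pU pS' (negPf qU) pS //=.
  rewrite (markerE je pU qU) ifN ?inE ?qw ?qx //.
  by apply: contraNneq qZ => ->.
have noQ' e p q : joins e p q -> p \in Q -> q \notin L w -> q \notin Z ->
    (q \in L x) || (q == x) -> q \in Q.
  move=> je pQ qw qZ qx; have qS : q \notin S.
    by case/orP: qx => [qx|/eqP ->] //; apply: pS.
  have qU : q \notin U.
    apply/negP => qU; rewrite joinsC in je.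
    by have := noQ _ _ _ je qU qS; rewrite pQ.
  rewrite !inE qw qZ qU /=; case/orP: qx => // /eqP qx.
  by rewrite qx xU in qU.
(* In [G - Z] fewer than [b + b] edges leave [Q], so [Q] cannot separate a vertex of [K] from [r].
   Hence moving [Q] keeps all traces on [K], as optimality demands. *)
have KQ p : p \in K -> p \notin Q.
  move=> pK; apply/negP => pQ; have [px pw pU pZ] := QP p pQ.
  have rQ : r \notin Q.
    by apply/negP => /QP[]; have [/negPf ->] := Lopt xK.
  have ge := linkedP _ _ _ _ (Klinked pK) Q pQ rQ.
  suff : cut Z Q <= cut (w |: Z) (L w) + cut (x |: Z) (L x).
    by clear -w2 x2 le_g ge; lia.
  apply: cut_le2_edge => e s t je sQ tQ sZ tZ; have [sx sw sU _] := QP s sQ.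
  have nsw : s != w by apply: contraNneq sU => ->.
  have nsx : s != x by apply: contraNneq sU => ->.
  rewrite /crosses !in_setU1 (negPf nsw) (negPf nsx) (negPf sZ) (negPf tZ) !orbF sx.
  rewrite (negPf sw) /=; have [tw|tw] := boolP (t \in L w).
    by rewrite (_ : t != w) //; apply: contraNneq w1 => e1; rewrite -{1}e1.
  have := noQ' _ _ _ je sQ tw tZ; case: (t \in L x); first by rewrite (negPf tQ) => /(_ isT).
  by case: (t == x); [rewrite (negPf tQ) => /(_ isT) | rewrite orbT].
have [rw ow] := Lopt wK; have [rx ox] := Lopt xK.
have [||le1 _] := ow (L w :|: Q).
- by rewrite inE negb_or w1; apply/negP => /QP[_ _]; rewrite wU.
- apply/setP => p; rewrite !inE; case pK: (p \in K); rewrite ?andbF // !andbT.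
  by have := KQ p pK; rewrite !inE => /negPf ->; rewrite orbF.
have [||_ le2] := ox (L x :\: Q).
- by rewrite inE (negPf x1) andbF.
- apply/setP => p; rewrite !inE; case pK: (p \in K); rewrite ?andbF // !andbT.
  by have := KQ p pK; rewrite !inE => ->.
have uQ : u \in Q by rewrite !inE uw ux uU uZ.
(* Enlarging [L w] cannot lower its cut, so shrinking [L x] does not raise its own. As [Q] contains
   [u], this contradicts the least size of [L x]. *)
suff sm : cut (w |: Z) (L w :|: Q) + cut (x |: Z) (L x :\: Q) <=
          cut (w |: Z) (L w) + cut (x |: Z) (L x).
  have : cut (x |: Z) (L x :\: Q) <= cut (x |: Z) (L x) by clear -le1 sm; lia.
  move/le2; rewrite leqNgt; case/negP; apply: proper_card; apply/properP.
  by split; [apply: subsetDl | exists u; rewrite // inE uQ].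
have nQ e p q : joins e p q ->
    [&& p \in Q, q \notin L w, q \notin Z & (q \in L x) || (q == x)] ==> (q \in Q).
  by move=> je; apply/implyP => /and4P[]; apply: noQ' je.
clearbody Q.
rewrite !cut_sum -!big_split; apply: leq_sum => e _ /=.
have [je1 je2] : joins e (src e) (tgt e) /\ joins e (tgt e) (src e).
  by rewrite /joins !eqxx orbT.
have := nQ e _ _ je1; have := nQ e _ _ je2.
move: (src e) (tgt e) => p q {je1 je2}; rewrite /crosses !in_setU1 !in_setU !in_setD.
case: (boolP (p \in Z)) => pZ; first by rewrite !orbT.
case: (boolP (q \in Z)) => qZ; first by rewrite !orbT !andbF.
have st t : t \notin Z ->
    [\/ [/\ t \in L w, t \in L x, t \notin Q, t != w & t != x],
        [/\ t \notin L w, t \in L x, t \in Q, t != w & t != x],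
        [/\ t \notin L w, t \in L x, t \notin Q, t == w & t != x]
      | [/\ t \notin L w, t \notin Q, t != w & (t == x) ==> (t \notin L x)]].
  move=> tZ.
  have [->|tw] := eqVneq t w.
    constructor 3; split=> //; last by apply: contraNneq x1 => e1; rewrite -{1}e1.
    by apply/negP => /QP[_ _]; rewrite wU.
  have [->|tx] := eqVneq t x.
    constructor 4; split=> //.
    + by apply: contra x1; apply/subsetP.
    + by apply/negP => /QP[_ _]; rewrite xU.
  have [tL|tL] := boolP (t \in L w).
    constructor 1; split=> //; first exact: (subsetP sLwx).
    by apply/negP => /QP[_]; rewrite tL.
  have [tQ|tQ] := boolP (t \in Q); last first.
    by constructor 4; split=> //; apply/implyP => /eqP; move: tx => /eqP.
  by constructor 2; split=> //; have [] := QP t tQ.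
case: (st p pZ) => [[p1 p2 p3 p4 p5]|[p1 p2 p3 p4 p5]|[p1 p2 p3 p4 p5]|[p1 p3 p4 p5]];
  case: (st q qZ) => [[q1 q2 q3 q4 q5]|[q1 q2 q3 q4 q5]|[q1 q2 q3 q4 q5]|[q1 q3 q4 q5]];
  move: p1 p3 p4 p5 q1 q3 q4 q5; try move: p2; try move: q2;
  case: (p \in L w) => //; case: (q \in L w) => //;
  case: (p \in Q) => //; case: (q \in Q) => //;
  case: (p == w) => //; case: (q == w) => //;
  case: (p \in L x) => //; case: (q \in L x) => //;
  case: (p == x) => //; case: (q == x) => //.
Qed.

End HubStep.

(** * Many gaps, seen from a vertex of [Z] *)

Section HubGaps.
Variables (G : mgraph) (Z K : {set vert G}) (b g k : nat) (a r : vert G).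
Variables (L : vert G -> {set vert G}).
Implicit Types (S U Y N : {set vert G}) (u v w x y p q : vert G).
Hypothesis le_g : k + (b + b) <= g.
Hypothesis aZ : a \in Z.
Hypothesis KZ : [disjoint K & Z].
Hypothesis Klinked : forall w, w \in K -> linked Z g w r.
Hypothesis Lcut : forall w, w \in K :\ r -> w \notin L w /\ cut (w |: Z) (L w) < b.
Hypothesis Lopt : forall w, w \in K :\ r -> r \notin L w /\ optimal Z K w (L w).

(* Every [k.+1]-st vertex of the chain becomes a branch vertex; it reaches [a]
   through the [k] gaps that follow it. *)
Lemma gap_hub n Y N : Y \subset K :\ r -> nested Y L -> Y \subset hits Y L N ->
    N \subset neighborhood a :\: Z -> n * k.+1 < #|Y| ->
  exists2 Z' : {set vert G}, #|Z'| = n & free k Z' a.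
Proof.
move=> /subsetP YK nst Yh /subsetP Na big.
have [s [Us sY sub]] := nested_enum nst.
have [f [fN fL fLL fI]] := gap_choice nst Yh.
have sz : #|Y| = size s by rewrite -(eq_card sY); apply/card_uniqP.
rewrite sz in big.
pose y i := nth r s i.
have yY i : i < size s -> y i \in Y by move=> si; rewrite -sY mem_nth.
have yK i : i < size s -> y i \in K :\ r by move=> si; apply/YK/yY.
have yI i j : i < size s -> j < size s -> y i = y j -> i = j.
  by move=> si sj /eqP; rewrite nth_uniq // => /eqP.
have ysub i j : i < j -> j < size s -> y i \in L (y j) /\ L (y i) \subset L (y j).
  move=> ij js; have := sub r i j; rewrite ij js => /(_ isT).
  by rewrite subUset sub1set => /andP[].
have br (i : 'I_n) : i * k.+1 < size s.
  by apply: leq_ltn_trans big; rewrite leq_mul2r ltnW ?orbT.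
pose B := [set y (i * k.+1) | i : 'I_n].
have BI : injective (fun i : 'I_n => y (i * k.+1)).
  move=> i j /(yI _ _ (br i) (br j))/eqP; rewrite eqn_mul2r /= => /eqP.
  exact: val_inj.
have BZ z : z \in B -> z \notin Z.
  move=> /imsetP[i _ ->]; have /setD1P[_ ?] := yK _ (br i); by rewrite (disjointFr KZ).
exists B; first by rewrite card_imset // card_ord.
apply/andP; split; first by apply/negP => /BZ; rewrite aZ.
apply/forall_inP => _ /imsetP[i _ ->]; pose i0 := i * k.+1.
apply: contraT => /linkedPn[U [wU aU lt]].
rewrite -/B -/i0 in lt wU *; pose S := B :\ y i0; rewrite -/S in lt.
have endb : i0 + k < size s.
  apply: leq_ltn_trans big; have := leq_mul (ltn_ord i) (leqnn k.+1).
  by rewrite mulSn -/i0; clear; lia.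
have Sidx j : i0 <= j <= i0 + k -> y j \notin S.
  move=> /andP[j1 j2]; apply/negP => /setD1P[jn /imsetP[i' _ jj]].
  have ej := yI _ _ (leq_ltn_trans j2 endb) (br i') jj.
  case/eqP: jn; rewrite ej; congr (y (_ * _)); rewrite ej /i0 in j1 j2.
  apply/eqP; rewrite eqn_leq; move: j1; rewrite leq_mul2r /= => ->.
  rewrite andbT -ltnS -(ltn_pmul2r (ltn0Sn k)); apply: leq_ltn_trans j2 _.
  by rewrite mulSn addnC ltn_add2r.
have Sgap j p : i0 <= j < i0 + k -> p \in L (y j.+1) -> p \notin L (y j) -> p \notin S.
  move=> /andP[j1 j2] pj1 pj; apply/negP => pS.
  have /setD1P[_ /imsetP[i' _ pp]] := pS; pose l := i' * k.+1.
  have ls : l < size s := br i'.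
  have js : j.+1 < size s by apply: leq_ltn_trans endb.
  case: (ltngtP l j) => lj.
  - have [yl _] := ysub l j lj (ltnW js).
    by move: pj; rewrite pp -/l yl.
  - have [_ self] := (I, nst.1 (y j.+1) (yY _ js)).
    move: lj; rewrite leq_eqVlt => /orP[/eqP lj|lj].
      by case/negP: self; move: pj1; rewrite pp -/l lj.
    have [_ /subsetP sb] := ysub j.+1 l lj ls; have := nst.1 (y l) (yY l ls).
    by rewrite sb // -/l -pp.
  - move: pS; rewrite pp -/l lj => pS; have := Sidx j.
    by rewrite j1 ltnW // => /(_ isT); rewrite pS.
have aS : a \notin S by apply/negP => /setD1P[_ /BZ]; rewrite aZ.
(* A set [U] with fewer than [k] crossing edges that contains a branch vertex swallows the next [k]
   vertices of the chain one by one. *)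
have step j : i0 <= j -> j <= i0 + k -> y j \in U.
  elim: j => [|j IH] j1 j2; first by move: j1; rewrite leqn0 => /eqP <-.
  move: j1; rewrite leq_eqVlt => /orP[/eqP <- //|]; rewrite ltnS => j1.
  have js : j.+1 < size s by apply: leq_ltn_trans endb.
  have [y1 y2] := ysub j j.+1 (ltnSn j) js.
  apply: (gap_linked le_g Klinked Lcut (yK j (ltnW js)) (yK _ js) y1 y2 (IH j1 (ltnW j2)) _ _ lt).
    by apply: Sidx; rewrite j2 ltnW.
  by move=> p; apply: Sgap; rewrite j1 j2.
(* Each of the [k] gaps supplies an edge across [U]. The markers lie in disjoint gaps, so these
   edges are distinct, too many for [U]. *)
have ex (t : 'I_k) : exists e, crosses S U (src e) (tgt e) &&
    (marker a U e \in L (y (i0 + t).+1) :\: L (y (i0 + t))).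
  set j := i0 + t.
  have j1 : i0 <= j by apply: leq_addr.
  have j2 : j < i0 + k by rewrite ltn_add2l.
  have js : j.+1 < size s by apply: leq_ltn_trans endb.
  have jY := yY j (ltnW js); have jY' := yY _ js.
  have [y1 y2] := ysub j j.+1 (ltnSn j) js.
  have := Na _ (fN _ jY); rewrite in_setD => /andP[fZ fa].
  have Sj : y j \notin S by apply: Sidx; rewrite j1 ltnW.
  have Sj' : y j.+1 \notin S by apply: Sidx; rewrite j2 ltnW.
  have Sp p : p \in L (y j.+1) -> p \notin L (y j) -> p \notin S.
    by apply: Sgap; rewrite j1 j2.
  have [e e1 e2] := gap_marker le_g aZ Klinked Lcut Lopt (yK j (ltnW js)) (yK _ js) y1 y2
    (step j j1 (ltnW j2)) (step j.+1 (leqW j1) j2)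
    Sj Sj' Sp aS aU (fLL _ _ jY jY' y1) (fL _ jY) fZ fa.
  by exists e; rewrite e1 e2.
have [h hP] := fin_all_exists ex.
have hI : injective h.
  have wl (t t' : 'I_k) : t < t' -> h t <> h t'.
    move=> tt eqh; have /andP[_] := hP t; have /andP[_] := hP t'.
    rewrite eqh !inE => /andP[n1 _] /andP[_ n2]; case/negP: n1.
    have ts : i0 + t' < size s.
      by apply: leq_ltn_trans endb; rewrite leq_add2l ltnW.
    have : (i0 + t).+1 <= i0 + t' by rewrite ltn_add2l.
    rewrite leq_eqVlt => /orP[/eqP <- //|tl].
    by have [_ /subsetP] := ysub _ _ tl ts; apply.
  move=> t t' eqh; apply: val_inj; case: (ltngtP t t') => // tt.
    by case: (wl _ _ tt).
  by case: (wl _ _ tt).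
move: lt; rewrite ltnNge /cut -[X in X <= _](card_ord k) -(card_imset _ hI).
case/negP; apply/subset_leq_card/subsetP => e /imsetP[t _ ->].
by rewrite inE; have /andP[] := hP t.
Qed.

End HubGaps.

(** * Assembling the decomposition *)

Lemma card_le_fibers (T I : finType) (f : T -> I) (A : {set T}) (B : {set I}) m :
    (forall x, x \in A -> f x \in B) ->
    (forall i, i \in B -> #|[set x in A | f x == i]| <= m) ->
  #|A| <= #|B| * m.
Proof.
move=> fB fib; rewrite -sum1_card (partition_big f (mem B)) //=.
rewrite -sum_nat_const; apply: leq_sum => i iB.
by rewrite sum1_card; apply: leq_trans (fib i iB); rewrite cardsE.
Qed.

Section Assembly.
Variables (G : mgraph) (W Z : {set vert G}) (h : vert G).
Variables (n k b g alpha beta : nat).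
Hypothesis Wconn : edge_connected alpha W.
Hypotheses (ZW : Z \subset W) (hW : h \in W) (hZ : h \notin Z).
Hypothesis Zfree : free beta Z h.
Hypothesis Zmax : forall Z' : {set vert G},
  Z' \subset W -> #|Z'| = #|Z|.+1 -> h \notin Z' -> ~~ free b Z' h.
Hypothesis nofree : forall (Z' : {set vert G}) a, #|Z'| = n -> ~~ free k Z' a.
Hypotheses (b_gt0 : 0 < b) (gE : g = k + (b + b)) (le_beta : b + (g + g) <= beta).
Hypothesis Zn : #|Z| < n.
Implicit Types (r t u v w x y : vert G) (N : {set vert G}).

(** The terms pay for [pre i], for [pre i.+1] and [L x], and for the sets of the tops, as in
    [cut_layer]. *)
Definition cut_bound := n * n * g + (n * n * g + b) + n * (n + n) * b.
(** There are at most [n * (n + n)] chains. In each, the last vertex is counted separately, and the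
    others number at most [b + b] by [gaps_outside] or [n * k.+1] by [gap_hub]. *)
Definition hit_bound := n * (n + n) * (b + b + n * k.+1).+1.
Definition linear_bound :=
  (g + n * (b + g)) + (n + n + n * (n + n)) + cut_bound + (hit_bound + hit_bound) + 1.

Hypothesis le_alpha : linear_bound <= alpha.

Let X0 := W :\: Z.
Definition class_root w := odflt w [pick r in X0 | linked Z g w r].

Lemma class_rootP w : w \in X0 -> class_root w \in X0 /\ linked Z g w (class_root w).
Proof.
move=> wX; rewrite /class_root; case: pickP => [r /andP[]//|/(_ w)].
by rewrite wX linked_refl.
Qed.

Lemma class_root_eq w x : w \in X0 -> linked Z g w x -> class_root w = class_root x.
Proof.
move=> wX wx; rewrite /class_root.
rewrite (eq_pick (Q := fun r => (r \in X0) && linked Z g x r)); last first.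
  move=> r; congr (_ && _); apply/idP/idP; last exact: linked_trans.
  by apply: linked_trans; rewrite linked_sym.
by case: pickP => //= /(_ w); rewrite wX linked_sym wx.
Qed.

Lemma class_root_linked w x : w \in X0 -> x \in X0 -> class_root w = class_root x ->
  linked Z g w x.
Proof.
move=> /class_rootP[_ lw] /class_rootP[_ lx] e; apply: linked_trans lw _.
by rewrite e linked_sym.
Qed.

Definition roots : {set vert G} := class_root @: X0.
Definition class r : {set vert G} := [set w in X0 | class_root w == r].

Lemma root_class r : r \in roots -> r \in class r.
Proof.
case/imsetP=> w wX ->; have [rX lr] := class_rootP wX.
by rewrite inE rX -(class_root_eq wX lr) eqxx.
Qed.

Lemma class_root_id r : r \in roots -> class_root r = r.
Proof. by move/root_class; rewrite inE => /andP[_ /eqP]. Qed.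

Lemma linked_roots r r' : r \in roots -> r' \in roots -> linked Z g r r' -> r = r'.
Proof.
move=> rR rR' l; rewrite -(class_root_id rR) -(class_root_id rR').
by apply: class_root_eq l; have := root_class rR; rewrite inE => /andP[].
Qed.

(* Given cuts [sep l l'] separating the classes pairwise, [pre i] separates the
   classes of index less than [i] from the others, and is monotone in [i]. *)
Definition index_root r := index r (enum roots).
Definition pre (sep : vert G -> vert G -> {set vert G}) i : {set vert G} :=
  [set u | [exists l in roots, (index_root l < i) &&
     [forall l' in roots, (i <= index_root l') ==> (u \in sep l l')]]].
Definition separating (sep : vert G -> vert G -> {set vert G}) :=
  forall r r', r \in roots -> r' \in roots -> r != r' ->
    [/\ r \in sep r r', r' \notin sep r r' & cut Z (sep r r') < g].

Lemma separating_exists : exists sep, separating sep.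
Proof.
have ex r : exists s : vert G -> {set vert G}, forall r', r \in roots -> r' \in roots ->
    r != r' -> [/\ r \in s r', r' \notin s r' & cut Z (s r') < g].
  have ex r' : exists U : {set vert G}, r \in roots -> r' \in roots ->
      r != r' -> [/\ r \in U, r' \notin U & cut Z U < g].
    have [rR|] := boolP (r \in roots); last by exists set0.
    have [rR'|] := boolP (r' \in roots); last by exists set0.
    have [rr|/linkedPn[U UP]] := boolP (linked Z g r r'); last by exists U.
    by exists set0; rewrite (linked_roots rR rR' rr) eqxx.
  by have [s sP] := fin_all_exists ex; exists s => r'; apply: sP.
by have [s sP] := fin_all_exists ex; exists s => r r'; apply: sP.
Qed.

Section Pre.
Variable sep : vert G -> vert G -> {set vert G}.
Hypothesis sepP : separating sep.

Lemma preP i u : reflect (exists l, [/\ l \in roots, index_root l < i &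
    forall l', l' \in roots -> i <= index_root l' -> u \in sep l l']) (u \in pre sep i).
Proof.
rewrite inE; apply: (iffP exists_inP) => [[l lR /andP[li /forall_inP H]]|[l [lR li H]]].
  by exists l; split=> // l' lR'; apply/implyP/H.
by exists l => //; rewrite li; apply/forall_inP => l' lR'; apply/implyP/H.
Qed.

Lemma pre_mono i j : i <= j -> pre sep i \subset pre sep j.
Proof.
move=> ij; apply/subsetP => u /preP[l [lR li H]]; apply/preP; exists l.
split=> //; first exact: leq_trans li ij.
by move=> l' lR' jl; apply: H lR' (leq_trans ij jl).
Qed.

Lemma root_in w : w \in X0 -> class_root w \in roots.
Proof. exact: imset_f. Qed.

(** Each [sep l l'] has fewer than [g] edges in its cut, so it cannot split a linkage class. *)
Lemma in_pre w i : w \in X0 -> (w \in pre sep i) = (index_root (class_root w) < i).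
Proof.
move=> wX; have [rX lw] := class_rootP wX; have rR := root_in wX.
apply/preP/idP => [[l [lR li H]]|wi].
  rewrite ltnNge; apply/negP => iw; have wl := H _ rR iw.
  have lr : l != class_root w by apply: contraTneq li => ->; rewrite -leqNgt.
  have [_ nr lt] := sepP lR rR lr.
  by have := linkedP _ _ _ _ lw _ wl nr; rewrite leqNgt lt.
exists (class_root w); split=> // l lR il; apply: contraT => wl.
have rl : class_root w != l by apply: contraTneq il => <-; rewrite -ltnNge.
have [rr _ lt] := sepP rR lR rl; rewrite linked_sym in lw.
by have := linkedP _ _ _ _ lw _ rr wl; rewrite leqNgt lt.
Qed.

Lemma cut_pre i : cut Z (pre sep i) <= #|roots| * #|roots| * g.
Proof.
pose R2 := setX roots roots.
apply: (@leq_trans (cut Z (set0 : {set vert G}) +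
    \sum_(p in [set p in R2 | p.1 != p.2]) cut Z (sep p.1 p.2))).
  apply: cut_le_sum => u v /preP[l [lR li H]] vP uZ vZ; apply/orP; right.
  have [l' [lR' il vl]] : exists l', [/\ l' \in roots, i <= index_root l' & v \notin sep l l'].
    have : ~~ [forall l' in roots, (i <= index_root l') ==> (v \in sep l l')].
      apply: contra vP => /forall_inP vl; apply/preP; exists l; split=> // l' lR'.
      exact/implyP/vl.
    by case/forall_inPn => l' lR'; rewrite negb_imply => /andP[]; exists l'.
  apply/existsP; exists (l, l'); rewrite !inE /= lR lR' /=.
  rewrite /crosses uZ vZ (H l' lR' il) (negPf vl) !andbT.
  by apply: contraTneq li => ->; rewrite -leqNgt.
rewrite cut_set0 add0n.
apply: (@leq_trans (\sum_(p in [set p in R2 | p.1 != p.2]) g)).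
  apply: leq_sum => -[r r']; rewrite !inE /= => /andP[/andP[rR rR'] rr].
  by have [_ _ /ltnW] := sepP rR rR' rr.
rewrite sum_nat_const leq_mul2r -cardsX; apply/orP; right.
by apply/subset_leq_card/subsetP => p; rewrite inE => /andP[].
Qed.

End Pre.

Lemma class_of r w : w \in class r -> w \in X0 /\ class_root w = r.
Proof. by rewrite inE => /andP[? /eqP]. Qed.

Lemma nonroot_class w : w \in X0 :\: roots -> w \in class (class_root w) :\ class_root w.
Proof.
rewrite in_setD => /andP[wR wX]; rewrite in_setD1 [w \in class _]in_set wX eqxx andbT.
by rewrite andbT; apply: contraNneq wR => e; rewrite e; apply: root_in.
Qed.

Definition forest (L : vert G -> {set vert G}) (c : vert G -> nat) : Prop :=
  forall r, r \in roots ->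
  [/\ forall w, w \in class r :\ r ->
        [/\ w \notin L w, cut (w |: Z) (L w) < b & c w < n + n],
      forall w x, w \in class r :\ r -> x \in class r :\ r -> w \in L x ->
        L w \subset L x /\ c x <= c w,
      forall w x, w \in class r :\ r -> x \in class r :\ r -> w != x -> c w = c x ->
        (w \in L x) || (x \in L w)
    & forall w, w \in class r :\ r -> r \notin L w /\ optimal Z (class r) w (L w)].

Lemma forest_exists : exists L c, forest L c /\ #|roots| <= n.
Proof.
have le_bg : b + b <= g by rewrite gE leq_addl.
have le_al : g + #|Z| * (b + g) <= alpha.
  apply: leq_trans le_alpha; rewrite /linear_bound -!addnA leq_add2l.
  by rewrite (leq_trans _ (leq_addr _ _)) // leq_mul2r ltnW ?orbT.
have [L0 [col [m [P1 P2 P3]]]] :=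
  cut_chains Wconn ZW hW hZ Zfree Zmax b_gt0 le_bg le_beta le_al.
have ex r : exists L : vert G -> {set vert G}, exists c : vert G -> nat, r \in roots ->
  [/\ forall w, w \in class r :\ r ->
        [/\ w \notin L w, cut (w |: Z) (L w) < b & c w < n + n],
      forall w x, w \in class r :\ r -> x \in class r :\ r -> w \in L x ->
        L w \subset L x /\ c x <= c w,
      forall w x, w \in class r :\ r -> x \in class r :\ r -> w != x -> c w = c x ->
        (w \in L x) || (x \in L w)
    & forall w, w \in class r :\ r -> r \notin L w /\ optimal Z (class r) w (L w)].
  have [rR|_] := boolP (r \in roots); last by exists (fun=> set0), (fun=> 0).
  have H1 w : w \in class r -> linked Z g w r.
    by move=> /class_of[wX <-]; have [] := class_rootP wX.
  have H2 w : w \in class r -> [/\ w \notin L0 w, cut (w |: Z) (L0 w) < b & col w < n].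
    move=> /class_of[wX _]; have [w1 w2 w3] := P1 w wX.
    by split=> //; apply: leq_ltn_trans Zn.
  have H3 w x : w \in class r -> x \in class r -> w != x -> col w = col x ->
      (w \in L0 x) (+) (x \in L0 w).
    move=> /class_of[wX wr] /class_of[xX xr] wx.
    by apply: P2 => //; apply: class_root_linked => //; rewrite wr.
  by have [L [c Lc]] := forest_of_chains le_bg (root_class rR) H1 H2 H3; exists L, c.
have [L LP] := fin_all_exists ex; have [c cP] := fin_all_exists LP.
exists (fun w => L (class_root w) w), (fun w => c (class_root w) w); split.
  move=> r rR; have [Q1 Q2 Q3 Q4] := cP r rR.
  have cr w : w \in class r :\ r -> class_root w = r by case/setD1P=> _ /class_of[].
  split.
  - by move=> w wr; rewrite cr //; apply: Q1.
  - by move=> w x wr xr; rewrite !cr //; apply: Q2.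
  - by move=> w x wr xr; rewrite !cr //; apply: Q3.
  - by move=> w wr; rewrite cr //; apply: Q4.
(* Every vertex is linked to [h] or to some [m z], which leaves at most [1 + #|Z|] classes. *)
apply: leq_trans (_ : #|class_root @: (h |: (m @: Z))| <= n).
  apply/subset_leq_card/subsetP => _ /imsetP[w wX ->].
  case: (P3 w wX) => [wh|[z zZ wz]].
    by rewrite (class_root_eq wX wh) imset_f // setU11.
  by rewrite (class_root_eq wX wz) imset_f // in_setU1 imset_f ?orbT.
apply: leq_trans (leq_imset_card _ _) _; rewrite cardsU1.
apply: leq_trans (_ : 1 + #|Z| <= n); last by [].
by apply: leq_add; [case: (_ \notin _) | apply: leq_imset_card].
Qed.

(** * One nested family from all classes and chains *)

Section Layers.
Variables (sep : vert G -> vert G -> {set vert G}).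
Variables (L : vert G -> {set vert G}) (c : vert G -> nat).
Hypotheses (sepP : separating sep) (forestP : forest L c) (roots_n : #|roots| <= n).
Let X1 := X0 :\: roots.

Lemma X1X0 w : w \in X1 -> w \in X0.
Proof. by case/setDP. Qed.

Lemma forest_cut w : w \in X1 -> [/\ w \notin L w, cut (w |: Z) (L w) < b & c w < n + n].
Proof.
move=> wX; have [H _ _ _] := forestP (root_in (X1X0 wX)).
by apply: H; apply: nonroot_class.
Qed.

Lemma forest_nested w x : w \in X1 -> x \in X1 -> class_root w = class_root x ->
  w \in L x -> L w \subset L x /\ c x <= c w.
Proof.
move=> wX xX e; have [_ H _ _] := forestP (root_in (X1X0 xX)).
have wc := nonroot_class wX; rewrite e in wc.
exact: H wc (nonroot_class xX).
Qed.

Lemma forest_total w x : w \in X1 -> x \in X1 -> class_root w = class_root x ->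
  w != x -> c w = c x -> (w \in L x) || (x \in L w).
Proof.
move=> wX xX e; have [_ _ H _] := forestP (root_in (X1X0 xX)).
have wc := nonroot_class wX; rewrite e in wc.
exact: H wc (nonroot_class xX).
Qed.

(** The set [L t] of a top contains the rest of its chain. Once [t] is deleted, it is a small cut
    that every later chain can absorb whole. *)
Definition tops : {set vert G} := [set t in X1 | [forall x in X1,
  [&& class_root x == class_root t, c x == c t & x != t] ==> (x \in L t)]].

Lemma topsP t : reflect (t \in X1 /\ forall x, x \in X1 -> class_root x = class_root t ->
    c x = c t -> x != t -> x \in L t) (t \in tops).
Proof.
rewrite /tops in_set; apply: (iffP andP) => -[tX H]; split=> //.
  move=> x xX e1 e2 xt; have := forall_inP H x xX.
  by rewrite e1 e2 !eqxx xt.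
by apply/forall_inP => x xX; apply/implyP => /and3P[/eqP e1 /eqP e2]; apply: H.
Qed.

Lemma top_exists w : w \in X1 -> exists t,
  [/\ t \in tops, class_root t = class_root w, c t = c w & (w == t) || (w \in L t)].
Proof.
move=> wX.
pose P y := [&& y \in X1, class_root y == class_root w & c y == c w].
have Pw : P w by rewrite /P wX !eqxx.
case: (arg_maxnP (fun y => #|L y|) Pw) => t /and3P[tX /eqP e1 /eqP e2] mx.
have top x : x \in X1 -> class_root x = class_root t -> c x = c t -> x != t -> x \in L t.
  move=> xX f1 f2 xt; have := forest_total xX tX f1 xt f2.
  case/orP=> // tx; have [tLx _] := forest_nested tX xX (esym f1) tx.
  have Px : P x by rewrite /P xX f1 f2 e1 e2 !eqxx.
  have : #|L t| < #|L x|.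
    apply/proper_card/properP; split=> //; exists t => //.
    by have [] := forest_cut tX.
  by rewrite ltnNge (mx x Px : #|L x| <= #|L t|).
exists t; split=> //; first by apply/topsP.
by have [//|wt] := eqVneq w t; apply: top.
Qed.

Lemma card_tops : #|tops| <= n * (n + n).
Proof.
have n0 : 0 < n by apply: leq_ltn_trans Zn.
have nn : (n + n).-1.+1 = n + n by rewrite prednK // addn_gt0 n0.
pose f t := (class_root t, inord (c t) : 'I_(n + n).-1.+1).
have fI : {in tops &, injective f}.
  move=> t t' /topsP[tX tt] /topsP[tX' tt'] [e1 /(congr1 (@nat_of_ord _))].
  have [_ _ c1] := forest_cut tX; have [n2 _ c2] := forest_cut tX'.
  rewrite !inordK ?nn // => e2; apply/eqP; apply: contraT => ne.
  have t1 : t \in L t' by apply: tt'.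
  have t2 : t' \in L t by apply: tt; rewrite // eq_sym.
  have [/subsetP sb _] := forest_nested tX tX' e1 t1.
  by rewrite (sb _ t2) in n2.
rewrite -(card_in_imset fI).
apply: leq_trans (_ : #|setX roots [set: 'I_(n + n).-1.+1]| <= _).
  apply/subset_leq_card/subsetP => _ /imsetP[t /topsP[tX _] ->].
  by rewrite in_setX in_setT andbT; apply/root_in/X1X0.
by rewrite cardsX cardsT card_ord nn leq_mul2r roots_n orbT.
Qed.

Definition removed : {set vert G} := Z :|: roots :|: tops.
Let X := W :\: removed.

Lemma X_X1 w : w \in X -> w \in X1 /\ w \notin tops.
Proof.
rewrite !in_setD !in_setU !negb_or => /andP[/andP[/andP[wZ wR] wT] wW].
by rewrite wR wZ wW.
Qed.

Lemma card_removed : #|removed| <= n + n + n * (n + n).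
Proof.
apply: leq_trans (leq_card_setU _ _) _; apply: leq_add card_tops.
by apply: leq_trans (leq_card_setU _ _) _; apply: leq_add => //; apply: ltnW.
Qed.

Lemma removed_sub : removed \subset W.
Proof.
rewrite !subUset ZW /=; apply/andP; split; apply/subsetP => w.
  by case/root_class/class_of => /setDP[].
by case/topsP=> /X1X0/setDP[].
Qed.

(** Chains of a class are placed by decreasing index: a vertex in [L x] has index at least [c x], so
    it never has to come after [x]. *)
Definition upto x : {set vert G} :=
  L x :|: \bigcup_(t in tops | (class_root t == class_root x) && (c x < c t)) L t.
(** Cuts of one class may spill into others; confining them between consecutive sets [pre] keeps the
    classes apart. *)
Definition layer x : {set vert G} :=
  pre sep (index_root (class_root x)) :|:
  (pre sep (index_root (class_root x)).+1 :&: upto x).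

Lemma uptoP x u : reflect (u \in L x \/ exists t, [/\ t \in tops,
    class_root t = class_root x, c x < c t & u \in L t]) (u \in upto x).
Proof.
rewrite in_setU; apply: (iffP orP) => -[uL|]; try by left.
  by case/bigcupP=> t /and3P[tT /eqP e lt] ut; right; exists t.
by case=> t [tT e lt ut]; right; apply/bigcupP; exists t => //; rewrite tT e eqxx lt.
Qed.

Lemma layer_self x : x \in X -> x \notin layer x.
Proof.
move=> /X_X1[xX xT]; have x0 := X1X0 xX.
rewrite in_setU in_setI !(in_pre sepP) // ltnn ltnSn /=; apply/negP => /uptoP[].
  by apply/negP; have [] := forest_cut xX.
case=> t [/topsP[tX _] e lt xt].
by have [_] := forest_nested xX tX (esym e) xt; rewrite leqNgt lt.
Qed.

Lemma index_root_inj x y : x \in X0 -> y \in X0 ->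
  index_root (class_root x) = index_root (class_root y) -> class_root x = class_root y.
Proof. by move=> /root_in rx /root_in ry; apply: index_enum_inj. Qed.

Lemma layer_sub x y : x \in X1 -> class_root x = class_root y -> x \in upto y ->
  upto x \subset upto y -> x |: layer x \subset layer y.
Proof.
move=> xX e xy sb; rewrite /layer -e subUset sub1set; apply/andP; split.
  by rewrite in_setU in_setI xy !(in_pre sepP) ?ltnSn ?orbT // X1X0.
by apply/setUS/setIS.
Qed.

Lemma nested_layer : nested X layer.
Proof.
split; first exact: layer_self.
wlog suff main : / forall x y, x \in X1 -> y \in X1 -> x \notin tops -> y \notin tops ->
    x != y ->
    [\/ index_root (class_root x) < index_root (class_root y),
        class_root x = class_root y /\ c y < c x
      | [/\ class_root x = class_root y, c x = c y & x \in L y]] ->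
    x |: layer x \subset layer y.
  move=> x y /X_X1[xX xT] /X_X1[yX yT] xy.
  have yx : y != x by rewrite eq_sym.
  case: (ltngtP (index_root (class_root x)) (index_root (class_root y))) => [lt|lt|e].
  - by rewrite (main x y) //; constructor 1.
  - by rewrite (main y x) ?orbT //; constructor 1.
  have {}e := index_root_inj (X1X0 xX) (X1X0 yX) e.
  case: (ltngtP (c x) (c y)) => cc.
  - by rewrite (main y x) ?orbT //; constructor 2.
  - by rewrite (main x y) //; constructor 2.
  case/orP: (forest_total xX yX e xy cc) => ll.
  - by rewrite (main x y) //; constructor 3.
  - by rewrite (main y x) ?orbT //; constructor 3.
move=> x y xX yX xT yT xy [lt|[e lt]|[e cc ll]].
- rewrite /layer subUset sub1set in_setU (in_pre sepP) ?X1X0 // lt /=.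
  apply: subset_trans (subsetUl _ _); rewrite subUset (pre_mono _ (ltnW lt)) /=.
  by apply: subset_trans (subsetIl _ _) (pre_mono _ lt).
(* The chain of [x] lies under a top [t], and [L t] is part of [upto y]. *)
- have [t [tT te tc]] := top_exists xX.
  have [xt|_ /= xt] := eqVneq x t; first by rewrite xt tT in xT.
  have [tX _] := topsP _ tT; have [/subsetP sb _] := forest_nested xX tX (esym te) xt.
  have ty u : u \in L t -> u \in upto y.
    by move=> ut; apply/uptoP; right; exists t; rewrite te tc.
  apply: layer_sub => //; first exact: ty.
  apply/subsetP => u /uptoP[/sb/ty//|[t' [tT' te' lt' ut']]].
  by apply/uptoP; right; exists t'; rewrite te' e (ltn_trans lt lt').
- have [/subsetP sb _] := forest_nested xX yX e ll.
  apply: layer_sub => //; first by apply/uptoP; left.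
  apply/subsetP => u /uptoP[/sb ul|[t' [tT' te' lt' ut']]]; apply/uptoP; first by left.
  by right; exists t'; rewrite te' e -cc.
Qed.

Lemma cut_layer x : x \in X -> cut (x |: removed) (layer x) <= cut_bound.
Proof.
move=> /X_X1[xX xT]; pose i := index_root (class_root x).
pose T (j : bool + vert G) := match j with inl true => Z | inl false => x |: Z
  | inr t => t |: Z end.
pose U (j : bool + vert G) := match j with inl true => pre sep i.+1 | inl false => L x
  | inr t => L t end.
pose P (j : bool + vert G) := if j is inr t then t \in tops else true.
apply: (@leq_trans (cut Z (pre sep i) + \sum_(j | P j) cut (T j) (U j))).
  apply: cut_le_sum => u v uD vD; rewrite !in_setU1 !in_setU !negb_or.
  move=> /andP[ux /andP[/andP[uZ uR] uT]] /andP[vx /andP[/andP[vZ vR] vT]].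
  move: vD; rewrite /layer -/i in_setU negb_or in_setI negb_and => /andP[vi vi1].
  move: uD; rewrite /layer -/i in_setU in_setI.
  have [ui _|ui /= /andP[ui1 uu]] := boolP (u \in pre sep i).
    by rewrite /crosses uZ vZ ui (negPf vi).
  apply/orP; right; apply/existsP; case/orP: vi1 => [vi1|vu].
    by exists (inl true); rewrite /= /crosses uZ vZ ui1 (negPf vi1).
  case/uptoP: uu => [uL|[t [tT te tc uL]]].
    exists (inl false); rewrite /= /crosses !in_setU1 !negb_or ux vx uZ vZ uL.
    have -> : v \in L x = false by apply: contraNF vu => vL; apply/uptoP; left.
    by [].
  exists (inr t); rewrite /= tT /crosses !in_setU1 !negb_or uZ vZ uL !andbT.
  have -> : v \in L t = false.
    by apply: contraNF vu => vL; apply/uptoP; right; exists t.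
  have -> : u != t by apply: contraNneq uT => ->.
  by have -> : v != t by apply: contraNneq vT => ->.
rewrite big_sumType /= big_bool /= /cut_bound -!addnA.
have pre_le j : cut Z (pre sep j) <= n * n * g.
  by apply: leq_trans (cut_pre sepP j) _; rewrite leq_mul2r leq_mul ?orbT.
have [_ /ltnW lx _] := forest_cut xX.
do 3 apply: leq_add => //; apply: (@leq_trans (\sum_(t in tops) b)).
  by apply: leq_sum => t /topsP[tX _]; have [_ /ltnW] := forest_cut tX.
by rewrite sum_nat_const leq_mul2r card_tops orbT.
Qed.

(** Along one chain the layers differ only through [L y], as the contributions of other classes and
    of tops are constant. A vertex [y'] above [y] in the chain keeps the gap after [y] from running
    into the next chain. *)
Lemma layer_hits_chain (Y : {set vert G}) N r q : Y \subset hits X layer N ->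
    (forall y, y \in Y -> class_root y = r /\ c y = q) ->
    (forall y, y \in Y -> exists2 y', y' \in X & [/\ class_root y' = r, c y' = q & y \in L y']) ->
  Y \subset hits Y L N.
Proof.
move=> /subsetP Yh Yrq Ymax.
have YX y : y \in Y -> y \in X by case/Yh/hitsP.
have above u y y' : y \in Y -> u \notin layer y ->
    (forall z, z \in X -> y \in layer z -> u \in layer z) -> y' \in X ->
    class_root y' = r -> c y' = q -> y \in L y' -> u \notin L y /\ u \in L y'.
  move=> yY uy uz yX' e' cc' ly; have [e cc] := Yrq y yY.
  have [yX yT] := X_X1 (YX y yY); have y0 := X1X0 yX.
  have : u \in layer y'.
    apply: uz => //; rewrite in_setU in_setI !(in_pre sepP) // e e' ltnn ltnSn /=.
    by apply/uptoP; left.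
  move: uy; rewrite !in_setU !in_setI e e'.
  case: (u \in pre sep (index_root r)) => //=; rewrite negb_and => + /andP[up uu].
  rewrite up /= => nu; split; first by apply: contra nu => uL; apply/uptoP; left.
  case/uptoP: uu => // -[t [tT te tc ut]]; case/negP: nu; apply/uptoP; right.
  by exists t; rewrite e te e' cc -cc'.
apply/subsetP => y yY; have /hitsP[yX [u [uN uy uz]]] := Yh y yY.
apply/hitsP; split=> //; exists u; split=> //.
  have [y' yX' [e' cc' ly]] := Ymax y yY.
  by have [] := above u y y' yY uy uz yX' e' cc' ly.
move=> y' yY' ly; have [e' cc'] := Yrq y' yY'.
by have [] := above u y y' yY uy uz (YX y' yY') e' cc' ly.
Qed.

Lemma hits_fiber a r q : a \in removed -> r \in roots ->
  #|[set y in hits X layer (neighborhood a :\: removed) |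
      (class_root y == r) && (c y == q)]| <= (b + b + n * k.+1).+1.
Proof.
move=> aR rR; set N := _ :\: _; set Y := [set y in _ | _].
have YP y : y \in Y -> [/\ y \in hits X layer N, y \in X, y \in X1,
    class_root y = r & c y = q].
  rewrite in_set => /and3P[yh /eqP e1 /eqP e2]; have /hitsP[yX _] := yh.
  by split=> //; have [] := X_X1 yX.
have nstY : nested Y L.
  split=> [y /YP[_ _ yX _ _]|y y' yY yY' yy]; first by have [] := forest_cut yX.
  have [_ _ yX e1 e2] := YP y yY; have [_ _ yX' e1' e2'] := YP y' yY'.
  have ee : class_root y = class_root y' by rewrite e1.
  case/orP: (forest_total yX yX' ee yy (etrans e2 (esym e2'))) => ll; apply/orP.
    by left; rewrite subUset sub1set ll; have [] := forest_nested yX yX' ee ll.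
  by right; rewrite subUset sub1set ll; have [] := forest_nested yX' yX (esym ee) ll.
have [->|Yn0] := eqVneq Y set0; first by rewrite cards0.
have [y0 y0Y mx] := nested_max nstY Yn0.
(* The vertex with the largest set may have nothing above it in the chain; it is the [.+1] of the
   bound. *)
pose Y0 := Y :\ y0; rewrite (cardsD1 y0) y0Y add1n ltnS -/Y0.
have Y0P y : y \in Y0 -> y \in Y /\ y != y0 by case/setD1P.
have nst0 : nested Y0 L := nested_sub (subsetDl _ _) nstY.
have h0 : Y0 \subset hits Y0 L N.
  apply: (layer_hits_chain (r := r) (q := q)).
  - by apply/subsetP => y /Y0P[/YP[]].
  - by move=> y /Y0P[/YP[]].
  - move=> y /Y0P[yY yy]; have [_ y0X _ e1 e2] := YP y0 y0Y; exists y0 => //.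
    by split=> //; apply: (subsetP (mx y yY yy)); rewrite setU11.
have Y0K : Y0 \subset class r :\ r.
  apply/subsetP => y /Y0P[/YP[_ _ yX <- _] _]; exact: nonroot_class.
have NZ : N \subset neighborhood a :\: Z.
  by apply: setDS; rewrite /removed -setUA subsetUl.
have KZ : [disjoint class r & Z].
  rewrite -setI_eq0; apply/eqP/setP => y; rewrite in_setI in_set0.
  by apply/negP => /andP[/class_of[/setDP[_ /negPf ->]]].
have [F1 F2 F3 F4] := forestP rR.
have [aZ|aZ] := boolP (a \in Z); last first.
  apply: leq_trans (leq_addr _ _); apply: (gaps_outside nst0 h0 NZ) => //.
  - apply: disjointWl KZ; apply: subset_trans Y0K (subsetDl _ _).
  - by apply/negP => /Y0P[/YP[_ + _ _ _] _]; rewrite in_setD aR.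
  - by move=> y /(subsetP Y0K)/F1[].
apply: leq_trans (leq_addl _ _); rewrite leqNgt; apply/negP => big.
have le_g : k + (b + b) <= g by rewrite gE.
have lk w : w \in class r -> linked Z g w r.
  by move=> /class_of[wX <-]; have [] := class_rootP wX.
have Lc w : w \in class r :\ r -> w \notin L w /\ cut (w |: Z) (L w) < b by case/F1.
have [Z' cZ' fr] := gap_hub le_g aZ KZ lk Lc F4 Y0K nst0 h0 NZ big.
by have := nofree a cZ'; rewrite fr.
Qed.

Lemma card_layer_hits a : a \in removed ->
  #|hits X layer (neighborhood a :\: removed)| <= hit_bound.
Proof.
move=> aR; have n0 : 0 < n by apply: leq_ltn_trans Zn.
have nn : (n + n).-1.+1 = n + n by rewrite prednK // addn_gt0 n0.
pose f t := (class_root t, inord (c t) : 'I_(n + n).-1.+1).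
apply: (leq_trans (@card_le_fibers _ _ f _ (setX roots setT) (b + b + n * k.+1).+1 _ _)).
- move=> y /hitsP[/X_X1[yX _] _]; rewrite in_setX in_setT andbT; exact/root_in/X1X0.
- move=> [r q]; rewrite in_setX in_setT andbT => rR.
  apply: leq_trans (hits_fiber q aR rR); apply/subset_leq_card/subsetP => y.
  rewrite in_set xpair_eqE => /andP[yh /andP[er /eqP eq]].
  have /hitsP[/X_X1[yX _] _] := yh; have [_ _ cy] := forest_cut yX.
  by rewrite in_set yh er -eq inordK ?nn // eqxx.
- by rewrite cardsX cardsT card_ord nn /hit_bound leq_mul2r leq_mul2r roots_n !orbT.
Qed.

End Layers.

Lemma linear_maximum_free : linear alpha W.
Proof.
have [sep sepP] := separating_exists.
have [L [c [Lc roots_n]]] := forest_exists.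
have al := le_alpha; rewrite /linear_bound in al.
apply: (@linear_of_nested G (removed L c) W (layer sep L c)).
- by clear -al; lia.
- exact: removed_sub.
- by have := card_removed Lc roots_n; clear -al; lia.
- exact: nested_layer sepP Lc.
- by move=> x xX; have := cut_layer sepP Lc roots_n xX; clear -al; lia.
- by move=> a aR; have := card_layer_hits sepP Lc roots_n aR; clear -al; lia.
Qed.

End Assembly.

(** * The theorem *)

(* [level k (n - j)] is the connectivity required of a free set of size [j]. *)
Fixpoint level k i : nat :=
  if i is i'.+1 then level k i' + ((k + (level k i' + level k i')) +
                                   (k + (level k i' + level k i'))) else k.

Lemma level_gt0 k i : 0 < k -> 0 < level k i.
Proof. by move=> k0; elim: i => //= i IH; rewrite addn_gt0 IH. Qed.

Lemma linear_no_free (G : mgraph) n k alpha (W : {set vert G}) :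
    0 < k -> 0 < alpha ->
    (forall (Z : {set vert G}) a, #|Z| = n -> ~~ free k Z a) ->
    (forall i, i < n ->
       linear_bound n k (level k i) (k + (level k i + level k i)) <= alpha) ->
    edge_connected alpha W ->
  linear alpha W.
Proof.
move=> k0 al0 nofree bound Wconn; have [->|/set0Pn[h0 h0W]] := eqVneq W set0.
  apply: (@linear_of_nested G set0 set0 (fun=> set0)) => //; try by move=> x; rewrite !inE.
  - by rewrite cards0.
  - by split=> x; rewrite !inE.
pose P j := (j <= n) && [exists Z : {set vert G}, exists h,
  [&& Z \subset W, h \in W, #|Z| == j & free (level k (n - j)) Z h]].
have P0 : exists j, P j.
  exists 0; rewrite /P /=; apply/existsP; exists set0; apply/existsP; exists h0.
  rewrite sub0set h0W cards0 /free inE /=; apply/forall_inP => z; by rewrite inE.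
have Pn j : P j -> j <= n by case/andP.
case: (ex_maxnP P0 Pn) => j /andP[jn /existsP[Z /existsP[h]]].
move=> /and4P[ZW hW /eqP cZ fr] mx.
(* At size [n] the level is [k], which [nofree] excludes. *)
have {}jn : j < n.
  rewrite ltn_neqAle jn andbT; apply/eqP => ejn; move: fr; rewrite ejn subnn /=.
  by apply/negP/nofree; rewrite cZ.
have [i ei] : exists i, n - j = i.+1 by exists (n - j).-1; rewrite prednK // subn_gt0.
have iE : n - j.+1 = i by rewrite subnS ei.
have hZ : h \notin Z by case/andP: fr.
apply: (@linear_maximum_free G W Z h n k (level k i) (k + (level k i + level k i))
  alpha (level k (n - j)) Wconn ZW hW hZ fr _ nofree) => //.
- move=> Z' ZW' cZ' hZ'; apply/negP => fr'.
  suff /mx : P j.+1 by rewrite ltnn.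
  rewrite /P jn; apply/existsP; exists Z'; apply/existsP; exists h.
  by rewrite ZW' hW cZ' cZ eqxx iE.
- exact: level_gt0.
(* The recursion of [level] is the equality case of this inequality. *)
- by rewrite ei /=.
- by rewrite cZ.
- by apply: bound; rewrite -iE; clear -jn; lia.
Qed.

Theorem theorem1 :
  forall F : mgraph, exists alpha : nat, 1 <= alpha /\
    forall G : mgraph,
      ~ contains_strong_immersion G F ->
      forall W : {set vert G}, edge_connected alpha W -> linear alpha W.
Proof.
(* The successor keeps [k] positive when [F] has no edges. *)
move=> F; pose n := #|vert F|; pose k := #|{: edge F * bool}|.+1.
pose B i := linear_bound n k (level k i) (k + (level k i + level k i)).
exists (\max_(i < n) B i).+1; split=> // G noF W Wconn.
apply: (linear_no_free (n := n) (k := k)) Wconn => // [Z a cZ|i lt_in].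
  by apply/negP => fr; apply: noF; apply: free_immersion cZ _ fr; apply: leqnSn.
by apply/leqW/(leq_bigmax (F := fun i : 'I_n => B i) (Ordinal lt_in)).
Qed.
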